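(* For every partition $\lambda$, $$F_\lambda\,\mathrm{He}_\lambda(x)=\sum_{j=0}^{\lfloor|\lambda|/2\rfloor}(-1)^j\frac{|\lambda|!}{j!\,(|\lambda|-2j)!\,2^j}\,a(\lambda,j)\,x^{|\lambda|-2j},$$ where $a(\lambda,j)$ is the value of the irreducible character of the symmetric group $S_{|\lambda|}$ associated to $\lambda$ on the conjugacy class of cycle type $(2^j,1^{|\lambda|-2j})$.
   Context: A partition is $\lambda=(\lambda_1\ge\dots\ge\lambda_{\ell(\lambda)}>0)$ with size $|\lambda|=\sum\lambda_i$; degree vector $n_i=\lambda_i+\ell(\lambda)-i$, $\Delta(n_\lambda)=\prod_{i<j}(n_j-n_i)$. Monic Hermite polynomials: $\mathrm{He}_0=1$, $\mathrm{He}_1=x$, $\mathrm{He}_n=x\mathrm{He}_{n-1}-(n-1)\mathrm{He}_{n-2}$. Wronskian Hermite polynomial: $\mathrm{He}_\lambda=\mathrm{Wr}[\mathrm{He}_{n_1},\dots,\mathrm{He}_{n_{\ell(\lambda)}}]/\Delta(n_\lambda)$, $\mathrm{He}_\emptyset=1$. $F_\lambda$ denotes the number of standard Young tableaux of shape $\lambda$. $(2^j,1^{m})$ denotes the cycle type with $j$ cycles of length 2 and $m$ fixed points. *)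

(* Defs.v *)
From HB Require Import structures.
From mathcomp Require Import all_boot all_order all_algebra all_fingroup all_solvable all_field all_character.
Set Implicit Arguments.
Unset Strict Implicit.
Unset Printing Implicit Defensive.
Import Order.TTheory GRing.Theory Num.Theory.
Local Open Scope ring_scope.

Definition is_partition (l : seq nat) : bool :=
  sorted geq l && all (fun x => 0 < x)%N l.

Definition psize (l : seq nat) : nat := sumn l.

Definition conj_part (l : seq nat) : seq nat :=
  mkseq (fun k => count (fun x => k < x)%N l) (head 0%N l).

Definition degvec (l : seq nat) (i : nat) : nat :=
  (nth 0 l i + size l - 1 - i)%N.

Section Hermite.
Variable R : comNzRingType.
Fixpoint He_pair (n : nat) : {poly R} * {poly R} :=
  match n with
  | 0 => (1, 'X)
  | m.+1 => let: (a, b) := He_pair m in (b, 'X * b - (m.+1)%:R *: a)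
  end.
Definition He (n : nat) : {poly R} := (He_pair n).1.

Definition Wronskian (k : nat) (f : 'I_k -> {poly R}) : {poly R} :=
  \det (\matrix_(i < k, j < k) (f j)^`(i)).
End Hermite.

Definition Delta_deg (l : seq nat) : int :=
  \prod_(i < size l) \prod_(j < size l | (i < j)%N)
     ((degvec l j)%:Z - (degvec l i)%:Z).

Definition HeW (l : seq nat) : {poly algC} :=
  ((Delta_deg l)%:~R)^-1 *:
    Wronskian (fun i : 'I_(size l) => He algC (degvec l i)).

Definition in_shape (l : seq nat) (c : nat * nat) : bool := (c.2 < nth 0 l c.1)%N.

(* A standard Young tableau of shape l: a bijection from the cells of l
   (which all lie in 'I_n x 'I_n, n = |l|) onto 'I_n (entries 0..n-1),
   strictly increasing along rows and down columns; non-cells are sent to 0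
   (normalisation, so that tableaux are counted once). *)
Definition is_SYT (l : seq nat) (T : {ffun 'I_(psize l) * 'I_(psize l) -> 'I_(psize l)}) : bool :=
  let cell (c : 'I_(psize l) * 'I_(psize l)) := in_shape l (val c.1, val c.2) in
  [forall c, ~~ cell c ==> (val (T c) == 0%N)] &&
  [forall c, forall d, (cell c && cell d && (T c == T d)) ==> (c == d)] &&
  [forall c, forall d, (cell c && cell d) ==>
     ((((val c.1 == val d.1) && (val c.2 < val d.2)%N) ==> (val (T c) < val (T d))%N) &&
      (((val c.2 == val d.2) && (val c.1 < val d.1)%N) ==> (val (T c) < val (T d))%N))].

Arguments is_SYT : clear implicits.

Definition nSYT (l : seq nat) : nat := #|[set T | is_SYT l T]|.

(* Permutation character of S_n acting on tabloids of (composition) shape mu,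
   i.e. Ind_{S_mu}^{S_n} 1 evaluated at g: number of row-assignments
   f : {0..n-1} -> rows with row r of size mu_r, fixed by g. *)
Definition tabloid_char (n : nat) (mu : seq nat) (g : 'S_n) : nat :=
  #|[set f : {ffun 'I_n -> 'I_(size mu)} |
      [forall r, #|[set x | f x == r]| == nth 0 mu r] &&
      [forall x, f (g x) == f x]]|.

Arguments tabloid_char : clear implicits.

Definition sgn_perm (n : nat) (g : 'S_n) : algC := (-1) ^+ odd_perm g.

(* The irreducible character chi^lambda of S_{|lambda|}: the (unique)
   irreducible constituent common to the tabloid module M^lambda and
   sgn (x) M^{lambda'} (Young's rule / James' characterisation of the
   Specht module S^lambda).  The condition "<chi, pi> <> 0" is written with
   the unnormalised sum (pi real-valued). *)
Definition young_irr_pred (l : seq nat) (i : Iirr [set: 'S_(psize l)]) : bool :=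
  (\sum_(g : 'S_(psize l)) 'chi_i g * (tabloid_char (psize l) l g)%:R != 0) &&
  (\sum_(g : 'S_(psize l)) 'chi_i g * sgn_perm g * (tabloid_char (psize l) (conj_part l) g)%:R != 0).

Arguments young_irr_pred : clear implicits.

Definition chi_part (l : seq nat) (g : 'S_(psize l)) : algC :=
  match [pick i | young_irr_pred l i] with
  | Some i => 'chi_i g
  | None => 0
  end.

Arguments chi_part : clear implicits.

Definition cycle_type (n : nat) (g : 'S_n) : seq nat :=
  sort geq [seq #|X| | X : {set 'I_n} <- enum (porbits g)].

Definition a_val (l : seq nat) (j : nat) : algC :=
  match [pick g : 'S_(psize l) |
           cycle_type g == nseq j 2%N ++ nseq (psize l - 2 * j) 1%N] with
  | Some g => chi_part l g
  | None => 0
  end.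

(* Main.v *)
(** In variables [y_1, ..., y_L] ([L] the number of parts of the partition), put
    [P_g(y) = \sum y_(f 1) ... y_(f n)], the sum being over the words [f] fixed
    by the permutation [g]; it is the power-sum product of the cycle type of [g]
    and the generating function of the tabloid characters.  Let [phi g] be the
    coefficient of [y^(lambda + delta)] in [a_delta(y) P_g(y)].  The
    Jacobi-Trudi identity shows that [phi] has norm 1, and counting 0-1 matrices
    with margins [lambda + delta - w(delta)] and the conjugate of [lambda]
    identifies it with the irreducible character defined by Young's rule.

    Summing [phi] over the involutions, weighted by [(-1)^j x^(n - 2j)], replaces
    the complete homogeneous polynomial [h_k] by [He_k / k!], because
    [exp (x p_1 t - p_2 t^2 / 2)] is the product over [i] of
    [exp (x y_i t - y_i^2 t^2 / 2)]; this gives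
    [n! det (He_(lambda_i - i + j) / (lambda_i - i + j)!)].  As [He_k' = k He_(k-1)],
    that determinant is also a scalar multiple of the Wronskian, and the scalar
    is determined by [F_lambda = n! det (1 / (lambda_i - i + j)!)], proved by
    removing the largest entry of a tableau. *)

Require Import Defs.
From HB Require Import structures.
From mathcomp Require Import all_boot all_order all_algebra all_fingroup all_solvable all_field all_character.
From mathcomp Require Import mpoly.
From mathcomp Require Import ring zify.
Set Implicit Arguments.
Unset Strict Implicit.
Unset Printing Implicit Defensive.
Import Order.TTheory GRing.Theory Num.Theory.
Local Open Scope ring_scope.

(** * Counting words by content *)

(** Value at [g] of the permutation character on words of content [m]. For ordinal letters this is
    [tabloid_char]; an arbitrary letter type allows pairs of letters as letters. *)
Definition fixc (J : finType) n (m : J -> nat) (g : 'S_n) : nat :=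
  #|[set f : {ffun 'I_n -> J} |
      [forall j, #|[set x | f x == j]| == m j] && [forall x, f (g x) == f x]]|.

Section WordAction.
Variables (J : finType) (n : nat).
Implicit Type f : {ffun 'I_n -> J}.

Definition word_act f (g : 'S_n) : {ffun 'I_n -> J} := [ffun x => f (g^-1%g x)].

Lemma word_act_is_action : is_action [set: 'S_n] word_act.
Proof.
apply: is_total_action => [f | f g h]; apply/ffunP => x; rewrite !ffunE.
  by rewrite invg1 perm1.
by rewrite invMg permM.
Qed.
Canonical word_action := Action word_act_is_action.

Lemma word_act_fixP f g : reflect (word_act f g = f) [forall x, f (g x) == f x].
Proof.
apply: (iffP forallP) => [fg | /ffunP fg x].
  by apply/ffunP=> x; rewrite ffunE -(eqP (fg _)) permKV.
by rewrite -(fg (g x)) ffunE permK.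
Qed.

Lemma word_act_content f g j :
  #|[set x | word_act f g x == j]| = #|[set x | f x == j]|.
Proof.
rewrite -(card_imset _ (@perm_inj _ g^-1%g)); congr #|pred_of_set _|.
apply/setP=> x; rewrite !inE; apply/imsetP/idP => [[y] | fx].
  by rewrite !inE ffunE => fy ->.
by exists (g x); rewrite ?permK // inE ffunE permK.
Qed.

Lemma count_codom f j : count_mem j (codom f) = #|[set x | f x == j]|.
Proof.
by rewrite /codom /image_mem count_map cardE /enum_mem size_filter count_filter;
  apply: eq_count => x; rewrite /= !inE andbT.
Qed.

Lemma same_content_orbit f f' :
  (forall j, #|[set x | f x == j]| = #|[set x | f' x == j]|) ->
  exists g : 'S_n, f' = word_act f g.
Proof.
move=> eq_ff'.
have : perm_eq [tuple f' i | i < n] [tuple f i | i < n].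
  have E (h : {ffun 'I_n -> J}) : [tuple h i | i < n] = codom h :> seq J by [].
  by apply/allP => j _; rewrite /= !E !count_codom eq_ff'.
case/tuple_permP=> p Ep; exists (p^-1)%g; apply/ffunP=> i; rewrite ffunE invgK.
have := congr1 (fun s => nth (f' i) s i) Ep.
rewrite -!(tnth_nth (f' i) [tuple f' i | i < n] i).
have -> : nth (f' i) [tuple tnth [tuple f i | i < n] (p i) | i < n] i =
          tnth [tuple tnth [tuple f i | i < n] (p i) | i < n] i by rewrite (tnth_nth (f' i)).
by rewrite !tnth_mktuple.
Qed.

Lemma content_exists (m : J -> nat) : (\sum_j m j)%N = n ->
  exists f : {ffun 'I_n -> J}, forall j, #|[set x | f x == j]| = m j.
Proof.
move=> sum_m; pose s := flatten [seq nseq (m j) j | j <- enum J].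
have size_s : size s == n.
  rewrite size_flatten /shape -map_comp sumnE big_map big_enum /= -sum_m.
  by apply/eqP; apply: eq_bigr => j _; rewrite size_nseq.
pose t := Tuple size_s.
exists [ffun i => tnth t i] => j; rewrite -count_codom /codom.
have -> : image_mem [ffun i => tnth t i] (mem 'I_n) = t.
  rewrite -[RHS]map_tnth_enum; apply: eq_map => i; exact: ffunE.
rewrite /= count_flatten -map_comp sumnE big_map big_enum (bigD1 j) //= big1 ?addn0.
  by rewrite count_nseq /= eqxx mul1n.
by move=> i /negPf ij; rewrite count_nseq /= ij.
Qed.

(** Orbit counting: the words of a given content form a single orbit, so the average number of fixed
    words is 1. *)
Theorem sum_fixc (m : J -> nat) : (\sum_j m j)%N = n ->
  (\sum_(g : 'S_n) fixc m g)%N = n`!.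
Proof.
move=> sum_m; pose S := [set f : {ffun 'I_n -> J} | [forall j, #|[set x | f x == j]| == m j]].
have actsS : [acts [set: 'S_n], on S | word_action].
  apply/actsP => g _ f; rewrite !inE; apply: eq_forallb => j.
  by rewrite word_act_content.
have -> : (\sum_(g : 'S_n) fixc m g)%N = (\sum_(g in [set: 'S_n]) #|'Fix_(S | word_action)[g]%g|)%N.
  apply: eq_big => [g | g _]; first by rewrite inE.
  apply: eq_card => f; rewrite !inE; congr (_ && _).
  by rewrite sub1set inE; apply/word_act_fixP/eqP.
rewrite (Frobenius_Cauchy actsS) cardsT card_Sn -[RHS]mul1n; congr (_ * _)%N.
have [f0 f0m] := content_exists sum_m.
rewrite -(cards1 (orbit word_action [set: 'S_n] f0)); apply: eq_card => O.
rewrite !inE; apply/imsetP/eqP => [[f fS ->] | ->].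
  rewrite inE in fS; apply/orbit_eqP/orbitP.
  have [|g Eg] := @same_content_orbit f0 f; last by exists g; rewrite ?inE.
  by move=> j; rewrite f0m (eqP (forallP fS j)).
by exists f0; rewrite // inE; apply/forallP=> j; rewrite f0m.
Qed.

(** A word without repeated letters is injective, so its stabiliser is trivial. *)
Lemma fixc1E (m : J -> nat) : (\sum_j m j)%N = n ->
  (forall j, m j <= 1)%N -> forall g : 'S_n, g != 1%g -> fixc m g = 0%N.
Proof.
move=> sum_m m1 g g1; apply/eqP; rewrite cards_eq0; apply/eqP/setP=> f.
rewrite !inE; apply/negP => /andP[/forallP fm /forallP fg].
case/negP: g1; apply/eqP/permP => x; rewrite perm1.
have := m1 (f x); rewrite -(eqP (fm (f x))) => /card_le1_eqP; apply.
  by rewrite inE.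
by rewrite inE fg.
Qed.

(* If some letter is repeated, multiplying by a transposition of two of its
   occurrences is a sign-reversing involution on the stabiliser of the word. *)
Theorem sum_sgn_fixc (m : J -> nat) : (\sum_j m j)%N = n ->
  \sum_(g : 'S_n) sgn_perm g * (fixc m g)%:R =
    (n`! * [forall j, m j <= 1]%N)%:R :> algC.
Proof.
move=> sum_m; case: forallP => m1.
  rewrite muln1 -(sum_fixc sum_m) natr_sum (bigD1 1%g) //= [RHS](bigD1 1%g) //=.
  rewrite /sgn_perm odd_perm1 mul1r; congr (_ + _).
  by apply: eq_bigr => g g1; rewrite fixc1E ?mulr0.
rewrite muln0; have [j mj] : exists j, (1 < m j)%N.
  apply/existsP; apply: contra_notT m1 => /existsPn m1 j; by rewrite leqNgt m1.
pose fx (f : {ffun 'I_n -> J}) (g : 'S_n) := [forall x, f (g x) == f x].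
pose S := [set f : {ffun 'I_n -> J} | [forall j, #|[set x | f x == j]| == m j]].
have -> : \sum_(g : 'S_n) sgn_perm g * (fixc m g)%:R =
   \sum_(f in S) \sum_(g | fx f g) sgn_perm g.
  rewrite (exchange_big_dep predT) //=; apply: eq_bigr => g _.
  rewrite sumr_const -[RHS]mulr_natr; congr (_ * _%:R).
  by apply: eq_card => f; rewrite [RHS]unfold_in /= !inE.
rewrite big1 // => f; rewrite inE => /forallP/(_ j)/eqP fm.
move: mj; rewrite -fm => /card_gt1P[a [b [fa fb ab]]]; rewrite !inE in fa fb.
have tS h : fx f (tperm a b * h)%g = fx f h.
  apply/forallP/forallP => H x; last first.
    by rewrite permM (eqP (H _)); case: tpermP => [->|->|//]; rewrite (eqP fa) (eqP fb).
  have := H (tperm a b x); rewrite permM tpermK => /eqP ->.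
  by case: tpermP => [->|->|//]; rewrite (eqP fa) (eqP fb).
have E : \sum_(g | fx f g) sgn_perm g = - \sum_(g | fx f g) sgn_perm g.
  rewrite {1}(reindex_inj (mulgI (tperm a b))) /= -sumrN.
  apply: eq_big => [h|h _]; first exact: tS.
  by rewrite /sgn_perm odd_permM odd_tperm ab; case: odd_perm; rewrite ?expr0 ?expr1 ?opprK.
by apply/eqP; rewrite -[_ == 0](mulrn_eq0 _ 2) mulr2n {1}E addNr.
Qed.

End WordAction.

(** * Pairs of words and matrices with prescribed margins *)

Lemma row_content (I J : finType) n (F : {ffun 'I_n -> I * J}) i :
  #|[set x | (F x).1 == i]| = (\sum_j #|[set x | F x == (i, j)]|)%N.
Proof.
rewrite -sum1_card (partition_big (fun x => (F x).2) predT) //=.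
apply: eq_bigr => j _; rewrite -sum1_card; apply: eq_bigl => x.
by rewrite !inE -pair_eqE.
Qed.

Lemma col_content (I J : finType) n (F : {ffun 'I_n -> I * J}) j :
  #|[set x | (F x).2 == j]| = (\sum_i #|[set x | F x == (i, j)]|)%N.
Proof.
rewrite -sum1_card (partition_big (fun x => (F x).1) predT) //=.
apply: eq_bigr => i _; rewrite -sum1_card; apply: eq_bigl => x.
by rewrite !inE andbC -pair_eqE.
Qed.

Definition margins (I J : finType) n (mu : I -> nat) (kap : J -> nat)
    (M : {ffun I * J -> 'I_n.+1}) : bool :=
  [forall i, \sum_j M (i, j) == mu i]%N && [forall j, \sum_i M (i, j) == kap j]%N.

(** A pair of words is one word over pairs of letters. Its content is a matrix whose row and column
    sums are the two given contents, and [g] fixes the pair exactly when it fixes the combined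
    word. *)
Lemma fixc_mul (I J : finType) n (mu : I -> nat) (kap : J -> nat) (g : 'S_n) :
  (fixc mu g * fixc kap g)%N =
  (\sum_(M : {ffun I * J -> 'I_n.+1} | margins mu kap M) fixc (fun c => M c) g)%N.
Proof.
rewrite /fixc -cardsX.
pose h (F : {ffun 'I_n -> I * J}) := ([ffun x => (F x).1], [ffun x => (F x).2]).
have h_inj : injective h.
  move=> F F' [/ffunP E1 /ffunP E2]; apply/ffunP => x.
  by have := E1 x; have := E2 x; rewrite !ffunE; case: (F x) (F' x) => ? ? [? ?] /= -> ->.
pose S := [set F : {ffun 'I_n -> I * J} | h F \in setX
  [set f : {ffun 'I_n -> I} | [forall j, #|[set x | f x == j]| == mu j] && [forall x, f (g x) == f x]]
  [set f : {ffun 'I_n -> J} | [forall j, #|[set x | f x == j]| == kap j] && [forall x, f (g x) == f x]]].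
transitivity #|S|.
  rewrite -(card_imset S h_inj); apply: eq_card => -[f f'].
  apply/idP/imsetP => [H|[F + ->]]; last by rewrite inE.
  exists [ffun x => (f x, f' x)]; last by congr pair; apply/ffunP => x; rewrite !ffunE.
  rewrite inE; suff -> : h [ffun x => (f x, f' x)] = (f, f') by [].
  by congr pair; apply/ffunP => x; rewrite !ffunE.
have ct_lt (F : {ffun 'I_n -> I * J}) c : (#|[set x | F x == c]| < n.+1)%N.
  by rewrite ltnS -[X in (_ <= X)%N]card_ord max_card.
pose ct F : {ffun I * J -> 'I_n.+1} := [ffun c => Ordinal (ct_lt F c)].
have Eh1 (F : {ffun 'I_n -> I * J}) i : #|[set x | [ffun x => (F x).1] x == i]| = (\sum_j ct F (i, j))%N.
  under eq_bigr do rewrite ffunE /=.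
  by rewrite -row_content; apply: eq_card => x; rewrite !inE ffunE.
have Eh2 (F : {ffun 'I_n -> I * J}) j : #|[set x | [ffun x => (F x).2] x == j]| = (\sum_i ct F (i, j))%N.
  under eq_bigr do rewrite ffunE /=.
  by rewrite -col_content; apply: eq_card => x; rewrite !inE ffunE.
have SE (F : {ffun 'I_n -> I * J}) : (F \in S) = margins mu kap (ct F) && [forall x, F (g x) == F x].
  rewrite !inE /= /margins.
  under eq_forallb => i do rewrite Eh1.
  under [in X in _ && (X && _)]eq_forallb => i do rewrite Eh2.
  rewrite -!andbA; congr (_ && _); rewrite andbCA; congr (_ && _).
  apply/andP/forallP => [[/forallP H1 /forallP H2] x|H].
    have := H1 x; have := H2 x; rewrite !ffunE => /eqP E1 /eqP E2.
    by rewrite [F (g x)]surjective_pairing E1 E2 -surjective_pairing.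
  by split; apply/forallP => x; rewrite !ffunE (eqP (H x)).
rewrite -sum1_card (partition_big ct (margins mu kap)) => [|F] /=; last first.
  by rewrite SE => /andP[].
apply: eq_bigr => M mM; rewrite -sum1_card; apply: eq_bigl => F.
rewrite SE !inE; apply/andP/andP => [[/andP[_ Fg] /eqP <-]|[/forallP FM Fg]]; split=> //.
  by apply/forallP => c; rewrite ffunE.
  suff -> : ct F = M by rewrite mM Fg.
  by apply/ffunP => c; apply: val_inj; rewrite ffunE /=; apply/eqP/FM.
by apply/eqP/ffunP => c; apply: val_inj; rewrite ffunE /=; apply/eqP/FM.
Qed.

Lemma margins_sum (I J : finType) n (mu : I -> nat) (kap : J -> nat)
    (M : {ffun I * J -> 'I_n.+1}) :
  margins mu kap M -> (\sum_c M c = \sum_i mu i)%N.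
Proof.
case/andP => /forallP rM _.
rewrite (eq_bigr (fun i => \sum_j M (i, j))%N) => [|i _]; last by rewrite (eqP (rM i)).
by rewrite pair_bigA; apply: eq_bigr => -[].
Qed.

Theorem sum_fixc_mul (I J : finType) n (mu : I -> nat) (kap : J -> nat) :
  (\sum_i mu i)%N = n ->
  (\sum_(g : 'S_n) fixc mu g * fixc kap g)%N =
    (n`! * #|[set M : {ffun I * J -> 'I_n.+1} | margins mu kap M]|)%N.
Proof.
move=> sum_mu; under eq_bigr do rewrite fixc_mul.
rewrite exchange_big /= -sum1_card big_distrr /= big_mkcond [RHS]big_mkcond /=.
apply: eq_bigr => M _; rewrite inE; case: ifP => // mM.
by rewrite muln1 sum_fixc // (margins_sum mM).
Qed.

(** After the sign twist, [sum_sgn_fixc] keeps only the matrices that, read as contents, repeat no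
    letter: these are the 0-1 matrices. *)
Theorem sum_sgn_fixc_mul (I J : finType) n (mu : I -> nat) (kap : J -> nat) :
  (\sum_i mu i)%N = n ->
  \sum_(g : 'S_n) sgn_perm g * (fixc mu g * fixc kap g)%:R =
    (n`! * #|[set M : {ffun I * J -> 'I_n.+1} |
               margins mu kap M && [forall c, M c <= 1]%N]|)%:R :> algC.
Proof.
move=> sum_mu; under eq_bigr do rewrite fixc_mul natr_sum mulr_sumr.
rewrite exchange_big /= -sum1_card natrM natr_sum mulr_sumr big_mkcond [RHS]big_mkcond /=.
apply: eq_bigr => M _; rewrite inE; case: ifP => //= mM.
rewrite sum_sgn_fixc ?(margins_sum mM) // natrM.
by case: ifP; rewrite ?mulr0.
Qed.

(** * Zero-one matrices and Young diagrams *)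

Lemma nth_partition (l : seq nat) i j :
  is_partition l -> (i <= j)%N -> (nth 0 l j <= nth 0 l i)%N.
Proof.
case/andP => l_sorted _ ij; have [jl|lj] := ltnP j (size l); last by rewrite nth_default.
have geq_trans : transitive geq by move=> a b c /= ba ac; apply: leq_trans ac ba.
have il := leq_ltn_trans ij jl.
exact: (sorted_leq_nth geq_trans leqnn 0%N l_sorted).
Qed.

Lemma sum_ord_ltn m k : (m <= k)%N -> (\sum_(j < k) (j < m) = m)%N.
Proof.
move=> mk; rewrite -big_mkcond /= -(big_ord_widen _ (fun=> 1%N) mk).
by rewrite sum1_card card_ord.
Qed.

Lemma size_conj_part l : size (conj_part l) = head 0%N l.
Proof. exact: size_mkseq. Qed.

Lemma nth_conj_part l j : (j < size (conj_part l))%N ->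
  nth 0%N (conj_part l) j = (\sum_(i < size l) (j < nth 0 l i))%N.
Proof.
rewrite size_conj_part => jl; rewrite nth_mkseq // -sum1_count (big_nth 0%N) big_mkord.
by rewrite big_mkcond.
Qed.

Lemma sum_partition_conj l i : is_partition l ->
  (\sum_(j < size (conj_part l)) (j < nth 0 l i) = nth 0 l i)%N.
Proof.
move=> lP; apply: sum_ord_ltn; rewrite size_conj_part -nth0.
exact: nth_partition.
Qed.

(* The hypothesis says that [mu] dominates [l]; comparing the number of ones in
   the first [r] rows of [M] with that of the Young diagram forces equality
   column by column. *)
Lemma ferrers_unique (l : seq nat) n (mu : 'I_(size l) -> nat)
    (M : {ffun 'I_(size l) * 'I_(size (conj_part l)) -> 'I_n.+1}) :
  is_partition l ->
  (forall r, \sum_(i < size l | i < r) nth 0 l i <= \sum_(i < size l | i < r) mu i)%N ->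
  margins mu (fun j : 'I_(size (conj_part l)) => nth 0%N (conj_part l) j) M -> (forall c, M c <= 1)%N ->
  forall i j, M (i, j) = (j < nth 0 l i)%N :> nat.
Proof.
move=> lP dom /andP[/forallP rowM /forallP colM] M1.
pose S r j := (\sum_(i < size l | i < r) M (i, j))%N.
pose Y r j := (\sum_(i < size l | i < r) (j < nth 0 l i))%N.
have SY r j : (S r j <= Y r j)%N.
  have [/existsP[i0 /andP[ir li]]|H] :=
    boolP [exists i : 'I_(size l), (i < r)%N && (nth 0 l i <= j)%N].
    have -> : Y r j = (\sum_(i < size l) (j < nth 0 l i))%N.
      rewrite /Y big_mkcond; apply: eq_bigr => i _; case: ltnP => // ri.
      by rewrite ltnNge (leq_trans _ li) // nth_partition // ltnW // (leq_trans ir).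
    rewrite -nth_conj_part // -(eqP (colM j)) /S big_mkcond.
    by apply: leq_sum => i _; case: ifP.
  apply: leq_sum => i ir; rewrite (leq_trans (M1 _)) //.
  rewrite lt0b ltnNge; apply: contra H => li; apply/existsP; exists i.
  by rewrite ir.
have SYe r j : S r j = Y r j.
  have : (\sum_(j < size (conj_part l)) Y r j <= \sum_(j < size (conj_part l)) S r j)%N.
    rewrite /S /Y exchange_big [X in (_ <= X)%N]exchange_big /=.
    under eq_bigr do rewrite sum_partition_conj //.
    by under [X in (_ <= X)%N]eq_bigr do rewrite (eqP (rowM _)).
  have := leqif_sum (fun j (_ : predT j) => leqif_geq (SY r j)).
  case=> SYs SYeq H; have := SYeq; rewrite eqn_leq SYs H => /esym/forallP/(_ j)/=.
  by move=> YS; apply/eqP; rewrite eqn_leq SY YS.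
move=> i j; have E (F : 'I_(size l) -> nat) :
    (\sum_(k < size l | k < i.+1) F k = F i + \sum_(k < size l | k < i) F k)%N.
  rewrite (bigD1 i) //=; congr addn; apply: eq_bigl => k.
  by rewrite ltnS andbC -ltn_neqAle.
by have := SYe i.+1 j; rewrite /S /Y !E -!/(S i j) -!/(Y i j) SYe => /addIn.
Qed.

(** The truncated difference [r - i] vanishes from [r] on, so its total over all indices is
    invariant under [w] and carried by the indices below [r]; restricting the permuted sum to a
    prefix can only lower it. *)
Lemma sum_perm_prefix L (w : 'S_L) r :
  (\sum_(i < L | i < r) i <= \sum_(i < L | i < r) w i)%N.
Proof.
have H : (\sum_(i < L | i < r) (r - w i) <= \sum_(i < L | i < r) (r - i))%N.
  apply: (@leq_trans (\sum_(i < L) (r - w i))%N).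
    by rewrite big_mkcond; apply: leq_sum => i _; case: ifP.
  have -> : (\sum_(i < L) (r - w i) = \sum_(i < L) (r - i))%N.
    by rewrite [RHS](reindex_inj (@perm_inj _ w)).
  rewrite [X in (_ <= X)%N]big_mkcond; apply: leq_sum => i _; case: ltnP => //.
  by rewrite -subn_eq0 => /eqP ->.
have E : (\sum_(i < L | i < r) r = \sum_(i < L | i < r) (r - i) + \sum_(i < L | i < r) i)%N.
  by rewrite -big_split; apply: eq_bigr => i ir; rewrite /= subnK // ltnW.
have : (\sum_(i < L | i < r) r <= \sum_(i < L | i < r) (r - w i) + \sum_(i < L | i < r) w i)%N.
  by rewrite -big_split; apply: leq_sum => i _ /=; lia.
by rewrite E; lia.
Qed.

(** The staircase [delta], decreasing, so that [degvec] is [lambda + delta]. *)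
Definition stair L (i : 'I_L) : nat := (L - 1 - i)%N.

Lemma degvecE l (i : 'I_(size l)) : degvec l i = (nth 0 l i + stair i)%N.
Proof. by rewrite /degvec /stair; have := ltn_ord i; lia. Qed.

Lemma stair_inj L : injective (@stair L).
Proof.
move=> i j; rewrite /stair => E; apply/val_inj.
by move: E (ltn_ord i) (ltn_ord j) => /=; lia.
Qed.

Lemma psizeE l : psize l = (\sum_(i < size l) nth 0 l i)%N.
Proof. by rewrite /psize sumnE (big_nth 0%N) big_mkord. Qed.

(** Permuting the decreasing staircase can only lower its partial sums, so subtracting [w(delta)]
    from [lambda + delta] leaves partial sums at least those of [lambda]. The hypothesis makes the
    natural subtraction exact. *)
Lemma shift_dominates l (w : 'S_(size l)) r :
  (forall i, stair (w i) <= degvec l i)%N ->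
  (\sum_(i < size l | i < r) nth 0 l i <=
     \sum_(i < size l | i < r) (degvec l i - stair (w i)))%N.
Proof.
move=> wl.
have E1 : (\sum_(i < size l | i < r) (degvec l i - stair (w i)) +
  \sum_(i < size l | i < r) stair (w i) =
  \sum_(i < size l | i < r) nth 0 l i + \sum_(i < size l | i < r) stair i)%N.
  by rewrite -!big_split; apply: eq_bigr => i _; rewrite /= -degvecE subnK.
have E2 (v : 'S_(size l)) :
    (\sum_(i < size l | i < r) stair (v i) + \sum_(i < size l | i < r) v i =
     \sum_(i < size l | i < r) (size l).-1)%N.
  rewrite -!big_split; apply: eq_bigr => i _ /=; rewrite /stair.
  by have := ltn_ord (v i); lia.
have arith a b c d e f : (a + b = c + d -> b + e = d + f -> f <= e -> c <= a)%N by lia.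
apply: (arith _ _ _ _ _ _ E1 _ (sum_perm_prefix w r)).
by rewrite E2 -(E2 1%g); congr addn; apply: eq_bigr => i _; rewrite perm1.
Qed.

Lemma sum_shift l (w : 'S_(size l)) : (forall i, stair (w i) <= degvec l i)%N ->
  (\sum_(i < size l) (degvec l i - stair (w i)) = psize l)%N.
Proof.
move=> wl; apply: (@addIn (\sum_(i < size l) stair (w i))%N).
have E : (\sum_(i < size l) stair (w i) = \sum_(i < size l) stair i)%N.
  by rewrite [RHS](reindex_inj (@perm_inj _ w)).
rewrite [in RHS]E psizeE -!big_split.
by apply: eq_bigr => i _; rewrite /= -degvecE subnK.
Qed.

(** By [ferrers_unique] the matrix must be the Young diagram, whose row sums are [lambda]; hence
    [w(delta) = delta] and [w] is the identity. *)
Lemma card_ferrers l (w : 'S_(size l)) : is_partition l ->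
  (forall i, stair (w i) <= degvec l i)%N ->
  #|[set M : {ffun 'I_(size l) * 'I_(size (conj_part l)) -> 'I_(psize l).+1} |
     margins (fun i : 'I_(size l) => degvec l i - stair (w i))%N (fun j : 'I_(size (conj_part l)) => nth 0%N (conj_part l) j) M
     && [forall c, M c <= 1]%N]| = (w == 1%g).
Proof.
move=> lP wl; set A := [set M | _].
have uniqM M : M \in A -> forall i j, M (i, j) = (j < nth 0 l i)%N :> nat.
  rewrite inE => /andP[mM /forallP M1].
  by apply: ferrers_unique mM M1 => // r; apply: shift_dominates.
have [/eqP w1 | w1] := boolP (w == 1%g); last first.
  apply/eqP; rewrite cards_eq0; apply/eqP/setP => M; rewrite [RHS]inE.
  apply: contraNF w1 => MA; apply/eqP/permP => i; rewrite perm1.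
  have := MA; rewrite inE => /andP[/andP[/forallP/(_ i)/eqP + _] _].
  under eq_bigr do rewrite (uniqM M MA).
  rewrite sum_partition_conj // => E; apply: (@stair_inj (size l)).
  by have := wl i; move: E; rewrite degvecE; lia.
have lt_cell (c : 'I_(size l) * 'I_(size (conj_part l))) :
    ((c.2 < nth 0 l c.1)%N < (psize l).+1)%N.
  rewrite ltnS; case: (ltnP c.2 _) => // cl; rewrite psizeE (bigD1 c.1) //=; lia.
apply/eqP/cards1P; exists [ffun c => Ordinal (lt_cell c)].
apply/setP => M; rewrite in_set1; apply/idP/eqP => [MA|->].
  by apply/ffunP => -[i j]; apply: val_inj; rewrite /= ffunE /= uniqM.
rewrite inE /margins -andbA; apply/and3P; split; apply/forallP => i.
- under eq_bigr do rewrite ffunE /=.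
  by rewrite sum_partition_conj // w1 perm1 degvecE addnK.
- under eq_bigr do rewrite ffunE /=.
  by rewrite nth_conj_part.
by rewrite ffunE /=; case: ltnP.
Qed.

(** * The Jacobi-Trudi identity *)

Section Words.
Variables (R : comNzRingType) (L : nat).

Definition wordsum n (g : 'S_n) : {mpoly R[L]} :=
  \sum_(f : {ffun 'I_n -> 'I_L} | [forall x, f (g x) == f x]) \prod_x 'X_(f x).

Lemma mcoeff_wordsum n (g : 'S_n) (nu : 'X_{1..L}) :
  (wordsum g)@_nu = (fixc nu g)%:R.
Proof.
rewrite /wordsum raddf_sum /= /fixc cardsE -sum1_card natr_sum.
rewrite big_mkcond [RHS]big_mkcond /=; apply: eq_bigr => f _; rewrite unfold_in andbC.
case: ifP => //= fg.
have -> : \prod_x 'X_(f x) = 'X_[R, [multinom #|[set x | f x == i]| | i < L]].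
  rewrite mpolyXE_id (partition_big f predT) //=; apply: eq_bigr => i _.
  rewrite mnmE -prodr_const.
  by apply: eq_big => [x|x /eqP ->]; rewrite ?inE.
rewrite mcoeffX; set b := _ == nu; set c := [forall j, _].
suff -> : b = c by case: c.
apply/eqP/forallP => [<- i|H]; first by rewrite mnmE.
by apply/mnmP => i; rewrite mnmE (eqP (H i)).
Qed.

(* Complete homogeneous polynomial of degree [k], correct as soon as [k <= N]. *)
Definition hsum N k : {mpoly R[L]} :=
  \sum_(m : {ffun 'I_L -> 'I_N.+1} | (\sum_j m j)%N == k) \prod_j 'X_j ^+ m j.

Lemma mcoeff_hsum N k (nu : 'X_{1..L}) : (k <= N)%N ->
  (hsum N k)@_nu = (mdeg nu == k)%:R.
Proof.
move=> kN; rewrite /hsum raddf_sum /=.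
have E (m : {ffun 'I_L -> 'I_N.+1}) :
    \prod_j 'X_j ^+ m j = 'X_[R, [multinom (m i : nat) | i < L]].
  by rewrite mpolyXE_id; apply: eq_bigr => j _; rewrite mnmE.
under eq_bigr do rewrite E mcoeffX.
have [nuk|nuk] := eqVneq; last first.
  apply: big1 => m /eqP mk; case: eqP => // mnu; case/eqP: nuk.
  by rewrite -mk mdegE -mnu; apply: eq_bigr => j _; rewrite mnmE.
have nuN j : (nu j < N.+1)%N.
  by rewrite ltnS (leq_trans _ kN) // -nuk mdegE (bigD1 j) //= leq_addr.
rewrite (bigD1 [ffun j => Ordinal (nuN j)]) /=; last first.
  by rewrite -nuk mdegE; apply/eqP/eq_bigr => j _; rewrite ffunE.
rewrite big1 ?addr0 => [|m /andP[_ mn]].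
  by rewrite (_ : _ == nu) //; apply/eqP/mnmP => i; rewrite mnmE ffunE.
case: eqP => // mnu; case/eqP: mn; apply/ffunP => j; apply: val_inj.
by rewrite ffunE /= -mnu mnmE.
Qed.

Lemma hsum_indep N N' k : (k <= N)%N -> (k <= N')%N -> hsum N k = hsum N' k.
Proof. by move=> kN kN'; apply/mpolyP => nu; rewrite !mcoeff_hsum. Qed.

(** At each monomial, both coefficients are [n!] times a number of matrices with row sums [nu]: on
    the right, row [i] is the exponent vector taken from the factor [h_(nu i)]. *)
Theorem sum_fixc_wordsum n (nu : 'I_L -> nat) : (\sum_i nu i)%N = n ->
  \sum_(g : 'S_n) (fixc nu g)%:R *: wordsum g = n`!%:R *: \prod_i hsum n (nu i).
Proof.
move=> sum_nu; apply/mpolyP => kap.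
rewrite raddf_sum /= mcoeffZ.
under eq_bigr do rewrite mcoeffZ mcoeff_wordsum -natrM.
rewrite -natr_sum sum_fixc_mul // natrM; congr (_ * _).
rewrite /hsum bigA_distr_big_dep raddf_sum /=.
pose cu (M : {ffun 'I_L * 'I_L -> 'I_n.+1}) := [ffun i => [ffun j => M (i, j)]].
pose uc (M : {ffun 'I_L -> {ffun 'I_L -> 'I_n.+1}}) := [ffun c => M c.1 c.2].
rewrite (reindex cu) /=; last first.
  exists uc => M _; first by apply/ffunP => -[i j]; rewrite !ffunE.
  by apply/ffunP => i; apply/ffunP => j; rewrite !ffunE.
rewrite cardsE -sum1_card natr_sum big_mkcond [RHS]big_mkcond /=.
apply: eq_bigr => M _; rewrite unfold_in /margins.
have -> : (cu M \in family (fun i (m : {ffun 'I_L -> 'I_n.+1}) => (\sum_j m j)%N == nu i)) =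
          [forall i, \sum_j M (i, j) == nu i]%N.
  apply/familyP/forallP => H i; have := H i; rewrite ?unfold_in.
    by under eq_bigr do rewrite !ffunE.
  by move=> /eqP <-; apply/eqP/eq_bigr => j _; rewrite !ffunE.
case: [forall i, \sum_j M (i, j) == nu i]%N => //=.
have -> : \prod_i \prod_j 'X_j ^+ cu M i j =
          'X_[R, [multinom (\sum_i M (i, j))%N | j < L]].
  rewrite exchange_big mpolyXE_id; apply: eq_bigr => j _.
  by rewrite mnmE -prodrXr; apply: eq_bigr => i _; rewrite !ffunE.
rewrite mcoeffX [RHS](_ : _ = if [forall j, \sum_i M (i, j) == kap j]%N then 1 else 0) //.
have -> : ([multinom (\sum_i M (i, j))%N | j < L] == kap) =
          [forall j, \sum_i M (i, j) == kap j]%N.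
  apply/eqP/forallP => [<- j|H]; first by rewrite mnmE.
  by apply/mnmP => j; rewrite mnmE (eqP (H j)).
by case: [forall j, _].
Qed.

(** The product of the series [1 / (1 - y_j t)], each truncated after degree [N]. *)
Definition hgen N : {poly {mpoly R[L]}} :=
  \prod_(j < L) \sum_(a < N.+1) ('X_j ^+ a) *: 'X^a.

Lemma coef_hgen N k : (hgen N)`_k = hsum N k.
Proof.
rewrite /hgen bigA_distr_bigA coef_sum /hsum [RHS]big_mkcond; apply: eq_bigr => m _.
rewrite scaler_prod prodrXr coefZ coefXn eq_sym.
by case: eqP; rewrite ?mulr1 ?mulr0.
Qed.

(** Generating function of the signed elementary symmetric polynomials in the variables other than
    [y_k]. Multiplied with [hgen], it leaves the geometric series of [y_k], up to truncation. *)
Definition cofactor_gen (k : 'I_L) : {poly {mpoly R[L]}} :=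
  \prod_(j < L | j != k) (1 - 'X_j *: 'X).

Lemma size_cofactor_gen k : (size (cofactor_gen k) <= L)%N.
Proof.
have szf j : (size (1 - 'X_j *: 'X : {poly {mpoly R[L]}})%R <= 2)%N.
  rewrite (leq_trans (size_polyD _ _)) // geq_max size_poly1 size_polyN /=.
  by rewrite (leq_trans (size_scale_leq _ _)) // size_polyX.
rewrite /cofactor_gen (leq_trans (size_prod_leq _ _)) //.
have -> : #|[pred j | j != k]| = L.-1 by rewrite cardC1 card_ord.
have : (\sum_(j < L | j != k) size (1 - 'X_j *: 'X : {poly {mpoly R[L]}})%R <= 2 * L.-1)%N.
  apply: (@leq_trans (\sum_(j < L | j != k) 2)%N); first by apply: leq_sum => j _; exact: szf.
  rewrite sum_nat_const mulnC leq_mul2l /=.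
  by rewrite -[X in (_ <= X.-1)%N](card_ord L) -(cardC1 k).
move=> le; rewrite leq_subLR.
apply: (@leq_trans (2 * L.-1).+1); first by rewrite ltnS.
by have := ltn_ord k; lia.
Qed.

Lemma geometric_poly (y : {mpoly R[L]}) N :
  (1 - y *: 'X) * (\sum_(a < N.+1) (y ^+ a) *: 'X^a) = 1 - (y ^+ N.+1) *: 'X^(N.+1).
Proof.
elim: N => [|N IH]; first by rewrite big_ord1 !expr0 scale1r mulr1 !expr1.
rewrite big_ord_recr mulrDr IH /= mulrBl mul1r -scalerAl -scalerAr scalerA -!exprS.
by rewrite addrA subrK.
Qed.

(** The factors left over by the truncated geometric series are 1 modulo ['X^(N.+1)]. *)
Lemma coef_mul_truncated (p : {poly {mpoly R[L]}}) (P : pred 'I_L) (y : 'I_L -> {mpoly R[L]}) N a :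
  (a <= N)%N -> (p * \prod_(j | P j) (1 - y j *: 'X^(N.+1)))`_a = p`_a.
Proof.
move=> aN; elim/big_rec: _ p => [|j q _ IH] p; first by rewrite mulr1.
rewrite mulrA IH mulrBr mulr1 coefB -scalerAr coefZ coefMXn ltnS aN mulr0 subr0 //.
Qed.

Lemma hsum_cofactor N k a : (a <= N)%N ->
  \sum_(b < L | (b <= a)%N) (cofactor_gen k)`_b * hsum N (a - b)%N = 'X_k ^+ a.
Proof.
move=> aN.
have E : cofactor_gen k * hgen N = (\sum_(a < N.+1) ('X_k ^+ a) *: 'X^a) *
   \prod_(j < L | j != k) (1 - ('X_j ^+ N.+1) *: 'X^(N.+1)).
  rewrite /hgen (bigD1 k) //= mulrCA /cofactor_gen -big_split /=; congr (_ * _).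
  by apply: eq_bigr => j _; rewrite geometric_poly.
have := congr1 (fun p : {poly _} => p`_a) E; rewrite coef_mul_truncated // coefM.
rewrite (_ : (\sum_(a < N.+1) 'X_k ^+ a *: 'X^a)`_a = 'X_k ^+ a); last first.
  rewrite coef_sum (bigD1 (Ordinal (aN : (a < N.+1)%N))) //= coefZ coefXn eqxx mulr1.
  rewrite big1 ?addr0 // => i; rewrite -val_eqE /= coefZ coefXn eq_sym => /negPf ->.
  by rewrite mulr0.
move=> <-; under [RHS]eq_bigr do rewrite coef_hgen.
pose F b : {mpoly R[L]} := (cofactor_gen k)`_b * hsum N (a - b)%N.
rewrite -(big_mkord (fun b => b <= a)%N F) -(big_mkord xpredT F).
(* The two sums run to [L] and to [a.+1]. Surplus terms vanish by the degree of [cofactor_gen k]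
   when [L] is the smaller bound, and by the condition [b <= a] otherwise. *)
have [La|La] := leqP L a.+1.
  rewrite (big_cat_nat (n := L) (leq0n _) La) //= [X in _ = _ + X]big_nat_cond.
  rewrite [X in _ = _ + X]big1 ?addr0 => [|b /andP[/andP[Lb _] _]].
    rewrite big_nat_cond [RHS]big_nat_cond; apply: eq_bigl => b.
    by rewrite andbT; case: (ltnP b L) => //= bL; lia.
  by rewrite /F nth_default ?mul0r // (leq_trans (size_cofactor_gen k)).
rewrite (big_cat_nat (n := a.+1) (leq0n _) (ltnW La)) //=.
rewrite [X in _ + X]big_nat_cond [X in _ + X]big1 ?addr0 => [|b]; last by lia.
rewrite big_nat_cond [RHS]big_nat_cond; apply: eq_bigl => b; lia.
Qed.

(** This is [h_(a - b)] with [h] zero at negative indices, where natural subtraction would give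
    [h_0]. For [al = lambda + delta] the matrix [JT] below has entries [h_(lambda_i - i + j)]. *)
Definition hshift N a b : {mpoly R[L]} := if (b <= a)%N then hsum N (a - b)%N else 0.

Definition JT N (al : 'I_L -> nat) : 'M[{mpoly R[L]}]_L :=
  \matrix_(i, j) hshift N (al i) (stair j).

Definition alternant (al : 'I_L -> nat) : {mpoly R[L]} :=
  \det (\matrix_(i < L, k < L) 'X_k ^+ al i).

Lemma JT_mul_cofactor N al : (forall i, al i <= N)%N ->
  JT N al *m (\matrix_(j < L, k < L) (cofactor_gen k)`_(stair j)) =
  \matrix_(i < L, k < L) 'X_k ^+ al i.
Proof.
move=> alN; apply/matrixP => i k; rewrite !mxE -(hsum_cofactor k (alN i)).
rewrite [RHS]big_mkcond (reindex_inj rev_ord_inj) /=; apply: eq_bigr => j _.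
rewrite !mxE /hshift (_ : stair (rev_ord j) = j); last first.
  by rewrite /stair /=; have := ltn_ord j; lia.
by case: ifP; rewrite ?mul0r // mulrC.
Qed.

(** The cofactor matrix does not depend on [al]. For the staircase itself the matrix of [h] is
    unitriangular, so the cofactor matrix has determinant [a_delta]. *)
Theorem jacobi_trudi N al : (forall i, al i <= N)%N ->
  \det (JT N al) * alternant (@stair L) = alternant al.
Proof.
move=> alN; rewrite /alternant -(JT_mul_cofactor alN) det_mulmx; congr (_ * _).
rewrite -(@JT_mul_cofactor L) ?det_mulmx; last by move=> i; rewrite /stair; lia.
rewrite -[RHS]mul1r; congr (_ * _).
rewrite -det_tr det_trig; last first.
  apply/is_trig_mxP => i j ij; rewrite !mxE /hshift ifF //.
  by rewrite /stair; move: (ltn_ord j) ij => /=; lia.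
rewrite big1 // => i _; rewrite !mxE /hshift leqnn subnn.
apply/mpolyP => nu; rewrite mcoeff_hsum // mdeg_eq0 mcoeff1 //.
Qed.

Lemma mcoeff_mulX (p : {mpoly R[L]}) (m a : 'X_{1..L}) :
  (p * 'X_[m])@_a = if [forall i, m i <= a i]%N then p@_(a - m) else 0.
Proof.
case: forallP => [ma|ma].
  have E : a = (m + (a - m))%MM.
    by apply/mnmP => i; rewrite mnmDE mnmBE subnKC // ma.
  by rewrite {1}E mcoeffMX.
rewrite [p]mpolyE mulr_suml raddf_sum /= big1 // => k _.
rewrite -scalerAl mcoeffZ -mpolyXD mcoeffX; case: eqP; rewrite ?mulr0 // => E.
by case: ma => i; rewrite -E mnmDE leq_addl.
Qed.

Lemma mcoeff_mul_alternant (p : {mpoly R[L]}) (a : 'X_{1..L}) :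
  (p * alternant (@stair L))@_a =
  \sum_(w : 'S_L) (-1) ^+ w * (if [forall i, stair (w i) <= a i]%N
     then p@_[multinom (a i - stair (w i))%N | i < L] else 0).
Proof.
rewrite /alternant -det_tr /determinant mulr_sumr raddf_sum; apply: eq_bigr => w _.
have -> : \prod_i (\matrix_(i < L, k < L) 'X_k ^+ stair i)^T i (w i) =
          'X_[R, [multinom stair (w i) | i < L]].
  by rewrite mpolyXE_id; apply: eq_bigr => i _; rewrite !mxE mnmE.
have -> : (-1) ^+ w = ((-1) ^+ w)%:MP_[L] :> {mpoly R[L]}.
  by rewrite rmorphXn rmorphN1.
rewrite mulrCA /= mcoeffCM mcoeff_mulX; congr (_ * _).
under eq_forallb do rewrite mnmE.
by case: ifP => // _; congr (_@__); apply/mnmP => i; rewrite mnmBE !mnmE.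
Qed.

(** With distinct exponents, only the identity term of the Leibniz expansion produces the monomial
    [a]. *)
Lemma mcoeff_alternant (a : 'X_{1..L}) : injective a -> (alternant a)@_a = 1.
Proof.
move=> a_inj; rewrite /alternant -det_tr /determinant raddf_sum (bigD1 1%g) //=.
have E (w : 'S_L) : ((-1) ^+ w * \prod_i (\matrix_(i < L, k < L) 'X_k ^+ a i)^T i (w i))@_a =
    (-1) ^+ w * ([multinom a (w i) | i < L] == a)%:R :> R.
  have -> : (-1) ^+ w = ((-1) ^+ w)%:MP_[L] :> {mpoly R[L]}.
    by rewrite rmorphXn rmorphN1.
  rewrite /= mcoeffCM; congr (_ * _); rewrite -mcoeffX mpolyXE_id; congr (_@__).
  by apply: eq_bigr => i _; rewrite !mxE mnmE.
rewrite E odd_perm1 expr0 mul1r big1 ?addr0 => [|w w1].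
  by rewrite (_ : _ == a) //; apply/eqP/mnmP => i; rewrite mnmE perm1.
rewrite E; case: eqP; rewrite ?mulr0 // => /mnmP wa.
case/eqP: w1; apply/permP => i; rewrite perm1; apply: a_inj.
by rewrite -[RHS]wa mnmE.
Qed.
End Words.

(** * The class function [phi]: norm and pairing with the sign-twisted tabloid character *)

Definition fits l (w : 'S_(size l)) : bool := [forall i, stair (w i) <= degvec l i]%N.

(** The determinantal form of [phi]: permutation characters of content [lambda + delta - w(delta)]
    with alternating signs, where contents with a negative part count as zero. *)
Definition spechtchar l (g : 'S_(psize l)) : algC :=
  \sum_(w : 'S_(size l) | fits w)
     (-1) ^+ w * (fixc (fun i : 'I_(size l) => degvec l i - stair (w i))%N g)%:R.
Arguments spechtchar : clear implicits.

Definition degmnm l : 'X_{1..(size l)} := [multinom degvec l i | i < size l].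

Lemma spechtchar_mcoeff l g :
  spechtchar l g = (wordsum algC (size l) g * alternant algC (@stair (size l)))@_(degmnm l).
Proof.
rewrite mcoeff_mul_alternant /spechtchar big_mkcond; apply: eq_bigr => w _.
rewrite /fits; under eq_forallb do rewrite -(mnmE (fun i : 'I_(size l) => degvec l i)).
case: ifP => _; rewrite ?mulr0 // mcoeff_wordsum; congr (_ * _%:R).
apply: eq_card => f; rewrite !inE; congr (_ && _).
by apply: eq_forallb => j; rewrite !mnmE.
Qed.

Lemma degvec_inj l : is_partition l -> injective (fun i : 'I_(size l) => degvec l i).
Proof.
move=> lP i j; wlog ij : i j / (i <= j)%N => [H|].
  by case: (leqP i j) => [/H|/ltnW/H H' /esym /H' /esym].
rewrite !degvecE /stair; have := nth_partition lP ij; have := ltn_ord j => jl le E.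
by apply: val_inj => /=; lia.
Qed.

(** Leibniz expansion: a permutation that does not fit meets a zero entry, and one that fits gives a
    content of total [psize l]. It serves both for [hsum] and for [hermite_h]. *)
Lemma sum_det_shift (A : comNzRingType) l (h : nat -> A) (F : ('I_(size l) -> nat) -> A) :
  (forall nu : 'I_(size l) -> nat, (\sum_i nu i)%N = psize l -> F nu = \prod_i h (nu i)) ->
  \sum_(w : 'S_(size l) | fits w)
     (-1) ^+ w * F (fun i => degvec l i - stair (w i))%N =
  \det (\matrix_(i < size l, j < size l)
     (if (stair j <= degvec l i)%N then h (degvec l i - stair j)%N else 0)).
Proof.
move=> HF; rewrite /determinant big_mkcond; apply: eq_bigr => w _.
case: ifP => [/forallP wl|/forallPn[i nwl]].
  rewrite HF ?sum_shift //; congr (_ * _).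
  by apply: eq_bigr => i _; rewrite mxE wl.
by rewrite (bigD1 i) //= mxE (negPf nwl) mul0r mulr0.
Qed.

(** The sum of [phi g] times [P_g] is [n!] times the Jacobi-Trudi determinant. Times [a_delta] it
    becomes [n! a_(lambda + delta)], whose coefficient at [y^(lambda + delta)] is [n!]. *)
Theorem spechtchar_norm l : is_partition l ->
  \sum_(g : 'S_(psize l)) spechtchar l g * spechtchar l g = (psize l)`!%:R :> algC.
Proof.
(* [N] bounds the degree vector, as [jacobi_trudi] requires; [hsum_indep] reconciles it with the
   truncation at [psize l] in [sum_fixc_wordsum]. *)
move=> lP; pose N := (\sum_(i < size l) degvec l i + psize l)%N.
pose aS := alternant algC (@stair (size l)).
have E : \sum_(g : 'S_(psize l)) spechtchar l g *: wordsum algC (size l) g =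
  (psize l)`!%:R *: \det (JT algC N (fun i : 'I_(size l) => degvec l i)).
  under eq_bigr do rewrite /spechtchar scaler_suml.
  rewrite exchange_big /=.
  rewrite -(@sum_det_shift _ l (hsum algC (size l) N)
    (fun nu => \prod_i hsum algC (size l) N (nu i))) // scaler_sumr.
  apply: eq_bigr => w /forallP wl.
  under eq_bigr do rewrite -scalerA.
  rewrite -scaler_sumr sum_fixc_wordsum ?sum_shift // scalerA mulrC -scalerA.
  congr (_ *: _); rewrite -mul_mpolyC rmorphXn rmorphN1; congr (_ * _).
  apply: eq_bigr => i _; apply: hsum_indep; last first.
    by rewrite /N (bigD1 i) //=; lia.
  by rewrite -(sum_shift wl) (bigD1 i) //= leq_addr.
transitivity ((\sum_(g : 'S_(psize l)) spechtchar l g *: wordsum algC (size l) g) * aS)@_(degmnm l).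
  rewrite mulr_suml raddf_sum /=; apply: eq_bigr => g _.
  by rewrite -scalerAl mcoeffZ -spechtchar_mcoeff.
rewrite E -scalerAl jacobi_trudi; last first.
  by move=> i; rewrite /N (bigD1 i) //=; lia.
rewrite mcoeffZ -[RHS]mulr1; congr (_ * _).
have -> : alternant algC (fun i : 'I_(size l) => degvec l i) = alternant algC (degmnm l).
  by congr (\det _); apply/matrixP => i j; rewrite !mxE mnmE.
apply: mcoeff_alternant => i j; rewrite !mnmE; exact: degvec_inj.
Qed.

(** By [card_ferrers], only the identity term of the alternating sum pairs nontrivially with the
    sign-twisted character. *)
Theorem spechtchar_sgn l : is_partition l ->
  \sum_(g : 'S_(psize l)) spechtchar l g * sgn_perm g *
     (tabloid_char (psize l) (conj_part l) g)%:R = (psize l)`!%:R.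
Proof.
move=> lP; under eq_bigr do rewrite /spechtchar !mulr_suml.
rewrite exchange_big /=.
have H (w : 'S_(size l)) : fits w ->
  \sum_(g : 'S_(psize l)) (-1) ^+ w *
    (fixc (fun i : 'I_(size l) => degvec l i - stair (w i))%N g)%:R * sgn_perm g *
    (tabloid_char (psize l) (conj_part l) g)%:R = ((psize l)`! * (w == 1%g))%:R :> algC.
  move=> /forallP wl; under eq_bigr do
    rewrite -!mulrA [_ * (sgn_perm _ * _)]mulrCA -natrM.
  rewrite -mulr_sumr (sum_sgn_fixc_mul (fun j : 'I_(size (conj_part l)) => nth 0%N (conj_part l) j)) ?sum_shift //.
  rewrite card_ferrers //; case: eqP => [->|_]; last by rewrite muln0 mulr0.
  by rewrite odd_perm1 mul1r.
rewrite (eq_bigr _ H) (bigD1 1%g) /=; last first.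
  by apply/forallP => i; rewrite perm1 degvecE leq_addl.
by rewrite eqxx muln1 big1 ?addr0 // => w /andP[_ /negPf ->]; rewrite muln0.
Qed.

Lemma sum_shift_sgn l (w : 'S_(size l)) : is_partition l -> fits w ->
  \sum_(g : 'S_(psize l)) sgn_perm g *
    (fixc (fun i : 'I_(size l) => degvec l i - stair (w i))%N g *
     tabloid_char (psize l) (conj_part l) g)%:R = ((psize l)`! * (w == 1%g))%:R :> algC.
Proof.
move=> lP /forallP wl.
rewrite (sum_sgn_fixc_mul (fun j : 'I_(size (conj_part l)) => nth 0%N (conj_part l) j)) ?sum_shift //.
by rewrite card_ferrers.
Qed.

(** * Young's rule *)

Section Characters.
Variables (J : finType) (n : nat).

Definition words (m : J -> nat) : {set {ffun 'I_n -> J}} :=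
  [set f : {ffun 'I_n -> J} | [forall j, #|[set x | f x == j]| == m j]].

Lemma word_act_words m f (g : 'S_n) : (word_act f g \in words m) = (f \in words m).
Proof. by rewrite !inE; apply: eq_forallb => j; rewrite word_act_content. Qed.

Definition words_mx m (g : 'S_n) : 'M[algC]_#|words m| :=
  \matrix_(i, j) (word_act (enum_val i) g == enum_val j)%:R.

Lemma words_mx_repr m : mx_repr [set: 'S_n] (words_mx m).
Proof.
split=> [|g h _ _]; apply/matrixP => i j; rewrite !mxE.
  rewrite (_ : word_act _ _ = enum_val i) ?(inj_eq enum_val_inj) //.
  by apply/ffunP => x; rewrite ffunE invg1 perm1.
have gm : word_act (enum_val i) g \in words m by rewrite word_act_words enum_valP.
rewrite (bigD1 (enum_rank_in gm (word_act (enum_val i) g))) //= !mxE enum_rankK_in // eqxx mul1r.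
rewrite big1 ?addr0 => [|k]; last first.
  move=> kE; rewrite !mxE; case: eqP => [E|_]; last by rewrite mul0r.
  by case/eqP: kE; apply: enum_val_inj; rewrite enum_rankK_in.
congr (_ == _)%:R; apply/ffunP => x; rewrite !ffunE invMg permM //.
Qed.

(** Realising [fixc] by permutation matrices makes it a genuine character, so its multiplicities are
    natural numbers. *)
Definition words_char m : 'CF([set: 'S_n]) := cfRepr (MxRepresentation (words_mx_repr m)).

Lemma words_char_char m : words_char m \is a character.
Proof. exact: cfRepr_char. Qed.

Lemma words_charE m (g : 'S_n) : words_char m g = (fixc m g)%:R.
Proof.
rewrite cfunE in_setT mulr1n /mxtrace /fixc.
under eq_bigr do rewrite mxE.
rewrite -(big_enum_val (fun f => (word_act f g == f)%:R)) /= -natr_sum; congr _%:R.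
rewrite -sum1_card big_mkcond [RHS]big_mkcond; apply: eq_bigr => f _; rewrite !inE.
case: [forall j, _] => //=.
by case: (word_act_fixP f g) => [->|/eqP/negPf ->]; rewrite ?eqxx.
Qed.
End Characters.

Definition sgn_mx n (g : 'S_n) : 'M[algC]_1 := (sgn_perm g)%:M.

Lemma sgn_mx_repr n : mx_repr [set: 'S_n] (@sgn_mx n).
Proof.
split=> [|g h _ _]; rewrite /sgn_mx /sgn_perm ?odd_perm1 //.
by rewrite odd_permM signr_addb scalar_mxM.
Qed.

Definition sgn_char n : 'CF([set: 'S_n]) := cfRepr (MxRepresentation (@sgn_mx_repr n)).

Lemma sgn_charE n (g : 'S_n) : sgn_char n g = sgn_perm g.
Proof. by rewrite cfunE in_setT mulr1n mxtrace_scalar. Qed.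

(** Multiplicities in characters are nonnegative, so dropping irreducibles from the expansion of the
    inner product can only lower it. *)
Lemma cfdot_char_ge (gT : finGroupType) (G : {group gT}) (A B : 'CF(G)) (I : {set Iirr G}) :
  A \is a character -> B \is a character ->
  \sum_(i in I) '[A, 'chi_i] * '[B, 'chi_i] <= '[A, B].
Proof.
move=> chA chB; rewrite [X in _ <= X]cfdot_sum_irr.
have nn i : 0 <= '[A, 'chi_i] * '[B, 'chi_i].
  by rewrite mulr_ge0 // natr_ge0 // Cnat_cfdot_char_irr.
rewrite [X in _ <= X](bigID (mem I)) /= -[X in X <= _]addr0 lerD //.
  apply: ler_sum => i _; rewrite (conj_natr (Cnat_cfdot_char_irr i chB)) //.
apply: sumr_ge0 => i _; rewrite (conj_natr (Cnat_cfdot_char_irr i chB)) //.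
Qed.

Section YoungRule.
Variable l : seq nat.
Hypothesis lP : is_partition l.
Notation n := (psize l).
Notation G := [set: 'S_n]%G.

Let rows_char : 'CF(G) := words_char n (fun i : 'I_(size l) => nth 0%N l i).
Let cols_char : 'CF(G) :=
  sgn_char n * words_char n (fun j : 'I_(size (conj_part l)) => nth 0%N (conj_part l) j).
Let shift_char (w : 'S_(size l)) : 'CF(G) :=
  words_char n (fun i : 'I_(size l) => degvec l i - stair (w i))%N.

Let specht : 'CF(G) := \sum_(w : 'S_(size l) | fits w) (-1) ^+ w *: shift_char w.

Let spechtE g : specht g = spechtchar l g.
Proof.
rewrite /specht sum_cfunE; apply: eq_bigr => w _; by rewrite cfunE words_charE.
Qed.

Let cfdot_SymE (phi psi : 'CF(G)) : (forall g, (psi g)^* = psi g) ->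
  '[phi, psi] = (n`!)%:R^-1 * \sum_(g : 'S_n) phi g * psi g.
Proof.
move=> psiR; rewrite cfdotE cardsT card_Sn; congr (_ * _).
by apply: eq_big => [g|g _]; rewrite ?inE ?psiR.
Qed.

Let cols_charE g : cols_char g = sgn_perm g * (tabloid_char n (conj_part l) g)%:R.
Proof. by rewrite cfunE sgn_charE words_charE. Qed.

Let cols_charR g : (cols_char g)^* = cols_char g.
Proof. by rewrite cols_charE rmorphM rmorph_nat /sgn_perm rmorph_sign. Qed.

Let rows_charR g : (rows_char g)^* = rows_char g.
Proof. by rewrite words_charE rmorph_nat. Qed.

Let spechtR g : (specht g)^* = specht g.
Proof.
rewrite spechtE /spechtchar rmorph_sum; apply: eq_bigr => w _.
by rewrite rmorphM rmorph_sign rmorph_nat.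
Qed.

Let factn0 : (n`!)%:R != 0 :> algC.
Proof. by rewrite pnatr_eq0 -lt0n fact_gt0. Qed.

Let cols_char_char : cols_char \is a character.
Proof. by rewrite rpredM ?cfRepr_char. Qed.

Let shift_charC w : shift_char w \is a character.
Proof. exact: words_char_char. Qed.

Let rows_charC : rows_char \is a character.
Proof. exact: words_char_char. Qed.

Let shift_dot w : fits w -> '[shift_char w, cols_char] = (w == 1%g)%:R.
Proof.
move=> wl; rewrite cfdot_SymE //.
under eq_bigr do rewrite words_charE cols_charE mulrCA -natrM.
by rewrite sum_shift_sgn // natrM mulKf.
Qed.

Let fits1 : fits (1%g : 'S_(size l)).
Proof. by apply/forallP => i; rewrite perm1 degvecE leq_addl. Qed.

Let shift1 : shift_char 1%g = rows_char.
Proof.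
apply/cfunP => g; rewrite !words_charE; congr _%:R.
apply: eq_card => f; rewrite !inE; congr (_ && _); apply: eq_forallb => i.
by rewrite perm1 degvecE addnK.
Qed.

(** A virtual character of norm 1 is irreducible up to sign, and the sign is positive because its
    inner product with the character [cols_char] is 1. *)
Let specht_irr : exists i, specht = 'chi_i.
Proof.
have Zs : specht \in 'Z[irr G]%g.
  by rewrite rpred_sum // => w _; rewrite rpredZsign char_vchar ?words_char_char.
have N1 : '[specht] = 1.
  rewrite cfdot_SymE //; under eq_bigr do rewrite !spechtE.
  by rewrite spechtchar_norm // mulVf.
have [b [i E]] := vchar_norm1P Zs N1; exists i.
have : '[specht, cols_char] = 1.
  rewrite cfdot_SymE //; under eq_bigr do rewrite spechtE cols_charE mulrA.
  by rewrite spechtchar_sgn // mulVf.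
rewrite E cfdotZl; case: b {E} (E) => [|_]; rewrite ?expr1 ?expr0 ?scale1r //.
rewrite mulN1r => _ H.
have := natr_ge0 (Cnat_cfdot_char (irr_char i) cols_char_char).
by rewrite -[X in 0 <= X]opprK H oppr_ge0 ler10.
Qed.

(** The irreducible [phi] occurs in both characters of Young's rule, and no other irreducible does,
    because ['[rows_char, cols_char]] is 1. *)
Theorem chi_partE g : chi_part l g = spechtchar l g.
Proof.
have [i Ei] := specht_irr.
have bi : '[cols_char, 'chi_i] = 1.
  rewrite -Ei cfdotC cfdot_SymE // -[RHS]conjC1; congr (_^*).
  under eq_bigr do rewrite spechtE cols_charE mulrA.
  by rewrite spechtchar_sgn // mulVf.
(* For [w != 1], [shift_char w] is orthogonal to [cols_char], which contains ['chi_i]; hence it does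
   not contain ['chi_i], and the norm 1 of [specht] comes from the identity term alone. *)
have ai : '[rows_char, 'chi_i] = 1.
  rewrite -shift1; have := cfnorm_irr i; rewrite -{1}Ei /specht cfdot_suml (bigD1 1%g) //=.
  rewrite odd_perm1 scale1r big1 ?addr0 // => w /andP[wl w1].
  have := cfdot_char_ge [set i] (shift_charC w) cols_char_char.
  rewrite big_set1 bi mulr1 shift_dot // (negPf w1) => le0.
  have ge0 := natr_ge0 (Cnat_cfdot_char_irr i (shift_charC w)).
  by rewrite cfdotZl (_ : '[_, _] = 0) ?mulr0 //; apply/eqP; rewrite eq_le le0.
have young k : young_irr_pred l k = ('[rows_char, 'chi_k] != 0) && ('[cols_char, 'chi_k] != 0).
  rewrite /young_irr_pred; congr (_ && _).
    rewrite cfdotC fmorph_eq0 cfdot_SymE // mulf_eq0 invr_eq0 (negPf factn0) /=.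
    by congr (_ != _); apply: eq_bigr => h _; rewrite words_charE.
  rewrite cfdotC fmorph_eq0 cfdot_SymE // mulf_eq0 invr_eq0 (negPf factn0) /=.
  by congr (_ != _); apply: eq_bigr => h _; rewrite cols_charE mulrA.
have young_i k : young_irr_pred l k = (k == i).
  rewrite young; apply/andP/eqP => [[ak bk]|->]; last by rewrite ai bi oner_eq0.
  apply/eqP; apply: contraTT isT => ki.
  (* A second common constituent [k] would push the inner product of the two characters above 1. *)
  have := cfdot_char_ge [set i; k] rows_charC cols_char_char.
  rewrite -{2}shift1 shift_dot // eqxx.
  rewrite big_setU1 ?inE 1?eq_sym //= big_set1 ai bi mulr1.
  rewrite -[X in _ <= X]addr0 lerD2l.
  have := Cnat_cfdot_char_irr k rows_charC.
  have := Cnat_cfdot_char_irr k cols_char_char.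
  move=> /natr_ge0 b0 /natr_ge0 a0 le0.
  have ab_gt0 : 0 < '[rows_char, 'chi_k] * '[cols_char, 'chi_k].
    by rewrite mulr_gt0 // lt0r ?ak ?bk ?a0 ?b0.
  by have := lt_le_trans ab_gt0 le0; rewrite ltxx.
rewrite /chi_part; case: pickP => [k|/(_ i)]; rewrite young_i ?eqxx //.
by move/eqP->; rewrite -Ei spechtE.
Qed.
End YoungRule.

(** * Involutions *)

(* Involutions of an [n]-set with [j] two-cycles: the last point is either fixed
   or exchanged with one of the others. *)
Fixpoint ninv (n j : nat) : nat :=
  match n with
  | 0 => (j == 0)%N
  | m.+1 => (ninv m j +
      match m, j with m'.+1, j'.+1 => m * ninv m' j' | _, _ => 0 end)%N
  end.

Lemma ninvSS m j : ninv m.+2 j.+1 = (ninv m.+1 j.+1 + m.+1 * ninv m j)%N.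
Proof. by []. Qed.

Lemma ninv0 n : ninv n 0 = 1%N.
Proof. by elim: n => //= n ->; case: n. Qed.

Lemma ninv_gt n j : (n < 2 * j)%N -> ninv n j = 0%N.
Proof.
elim/ltn_ind: n j => -[|[|n]] IH [|j] // nj.
by rewrite ninvSS !IH //; lia.
Qed.

(** The two terms of the recurrence contribute the shares [n - 2 * j] (fixed points) and [2 * j]
    (moved points) of the leading factor [n] of [n!]. *)
Lemma ninv_fact n j : (2 * j <= n)%N ->
  (ninv n j * (j`! * (n - 2 * j)`! * 2 ^ j) = n`!)%N.
Proof.
elim/ltn_ind: n j => n IH [|j] nj; first by rewrite ninv0 mul1n fact0 mul1n muln0 subn0 expn0 muln1.
case: n IH nj => [|[|n]] IH nj; [lia|lia|].
rewrite ninvSS mulnDl.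
have H2 : (n.+1 * ninv n j * (j.+1`! * (n.+2 - 2 * j.+1)`! * 2 ^ j.+1) =
           n.+1 * (2 * j.+1) * n`!)%N.
  rewrite -(IH n _ j); [|lia|lia].
  rewrite (_ : n.+2 - 2 * j.+1 = n - 2 * j)%N; last lia.
  by rewrite factS expnS; ring.
rewrite H2; have [nj'|nj'] := eqVneq n.+2 (2 * j.+1)%N.
  by rewrite ninv_gt ?mul0n ?add0n -?nj' ?factS; lia.
have E1 : (n.+2 - 2 * j.+1 = (n.+1 - 2 * j.+1).+1)%N by lia.
have IH1 := IH n.+1 (ltnSn _) j.+1 ltac:(lia).
rewrite E1 [(_ - _).+1`!]factS.
have -> : (ninv n.+1 j.+1 * (j.+1`! * ((n.+1 - 2 * j.+1).+1 * (n.+1 - 2 * j.+1)`!) * 2 ^ j.+1) =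
  (n.+1 - 2 * j.+1).+1 * n.+1`!)%N by rewrite -IH1; ring.
have E2 : (n.+2 = (n.+1 - 2 * j.+1).+1 + 2 * j.+1)%N by lia.
by rewrite [n.+2`!]factS [X in (_ = X * _)%N]E2 !factS; ring.
Qed.

Section Involutions.
Variable T : finType.
Implicit Types (A : {set T}) (g : {perm T}).

Definition invol_on A j : {set {perm T}} :=
  [set g | [&& perm_on A g, (g * g == 1)%g & #|[set x | g x != x]| == (2 * j)%N]].

Lemma involK g x : (g * g == 1)%g -> g (g x) = x.
Proof. by move/eqP => E; rewrite -permM E perm1. Qed.

Lemma invol_on_fix A j a : a \in A ->
  [set g in invol_on A j | g a == a] = invol_on (A :\ a) j.
Proof.
move=> aA; apply/setP => g; rewrite !inE -!andbA andbC -!andbA.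
rewrite [RHS]andbC -!andbA; congr (_ && _); congr (_ && _).
apply/andP/subsetP => [[ga /subsetP gA] x gx|gA].
  rewrite !inE gA ?andbT //; apply: contraNneq (gx : g x != x) => ->; exact: ga.
split; last by apply/subsetP => x /gA; rewrite !inE => /andP[].
by apply: contraT => ga; have := gA a ga; rewrite !inE eqxx.
Qed.

(** Multiplying by [tperm a b] removes the two-cycle exchanging [a] and [b] and leaves an involution
    of the other points; the same multiplication restores it. *)
Lemma invol_on_move A j a b : a \in A -> b \in A -> a != b ->
  [set g in invol_on A j.+1 | g a == b] =
  [set (tperm a b * g)%g | g in invol_on (A :\ a :\ b) j].
Proof.
move=> aA bA ab; have ba : b != a by rewrite eq_sym.
apply/setP => g; rewrite !inE; apply/andP/imsetP.
  case=> /and3P[gA gg sg] /eqP ga.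
  have gb : g b = a by rewrite -ga involK.
  exists (tperm a b * g)%g; last by rewrite mulgA tperm2 mul1g.
  have g'x x : x != a -> x != b -> (tperm a b * g)%g x = g x.
    by move=> xa xb; rewrite permM tpermD // eq_sym.
  have g'a : (tperm a b * g)%g a = a by rewrite permM tpermL.
  have g'b : (tperm a b * g)%g b = b by rewrite permM tpermR.
  have sE : [set x | g x != x] = a |: (b |: [set x | (tperm a b * g)%g x != x]).
    apply/setP => x; rewrite !inE; case: (eqVneq x a) => [->|xa]; first by rewrite ga.
    by case: (eqVneq x b) => [->|xb]; rewrite ?gb ?ab //= g'x.
  rewrite inE; apply/and3P; split.
  - apply/subsetP => x; rewrite !inE.
    case: (eqVneq x a) => [->|xa]; first by rewrite g'a eqxx.
    case: (eqVneq x b) => [->|xb]; first by rewrite g'b eqxx.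
    by rewrite g'x //= => gx; apply: (subsetP gA).
  - apply/eqP/permP => x; rewrite perm1 permM.
    case: (eqVneq x a) => [->|xa]; first by rewrite !g'a.
    case: (eqVneq x b) => [->|xb]; first by rewrite !g'b.
    rewrite (g'x x) // g'x ?involK //; apply/eqP => E.
      by case/eqP: xb; rewrite -(involK x gg) E ga.
    by case/eqP: xa; rewrite -(involK x gg) E gb.
  move: sg; rewrite sE !cardsU1 !inE g'a g'b !eqxx /= !negb_or ab /=; lia.
case=> g'; rewrite inE => /and3P[gA gg sg] ->.
have g'a : g' a = a by apply: (out_perm gA); rewrite !inE eqxx andbF.
have g'b : g' b = b by apply: (out_perm gA); rewrite !inE eqxx.
have E x : x != a -> x != b -> (tperm a b * g')%g x = g' x.
  by move=> xa xb; rewrite permM tpermD // eq_sym.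
have Ea : (tperm a b * g')%g a = b by rewrite permM tpermL.
have Eb : (tperm a b * g')%g b = a by rewrite permM tpermR.
split; last by rewrite Ea.
have sE : [set x | (tperm a b * g')%g x != x] = a |: (b |: [set x | g' x != x]).
  apply/setP => x; rewrite !inE; case: (eqVneq x a) => [->|xa]; first by rewrite Ea.
  by case: (eqVneq x b) => [->|xb]; rewrite ?Eb ?ab //= E.
apply/and3P; split.
- apply/subsetP => x; rewrite !inE.
  case: (eqVneq x a) => [->//|xa]; case: (eqVneq x b) => [->//|xb].
  by rewrite E // => gx; have := subsetP gA x gx; rewrite !inE => /and3P[].
- apply/eqP/permP => x; rewrite perm1 permM.
  case: (eqVneq x a) => [->|xa]; first by rewrite Ea Eb.
  case: (eqVneq x b) => [->|xb]; first by rewrite Eb Ea.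
  rewrite (E x) // E ?involK //; apply/eqP => E'.
    by case/eqP: xa; rewrite -(involK x gg) E' g'a.
  by case/eqP: xb; rewrite -(involK x gg) E' g'b.
rewrite sE !cardsU1 !inE g'a g'b !eqxx /= (negPf ab) /=; move: sg; lia.
Qed.

Lemma card_invol_on A j : #|invol_on A j| = ninv #|A| j.
Proof.
have [n] := ubnP #|A|; elim: n A j => // n IH A j An.
have [A0|[a aA]] := set_0Vmem A.
  rewrite A0 cards0 /=; case: (posnP j) => [->|j0].
    apply/eqP/cards1P; exists 1%g; apply/setP => g; rewrite !inE.
    apply/idP/eqP => [/and3P[g1 _ _]|->].
      by apply/permP => x; rewrite perm1 (out_perm g1) ?inE.
    rewrite perm_on1 mulg1 eqxx /= cards_eq0; apply/eqP/setP => x.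
    by rewrite !inE perm1 eqxx.
  apply/eqP; rewrite cards_eq0; apply/eqP/setP => g; rewrite !inE.
  apply/negP => /and3P[g1 _ sg].
  have g0 : [set x | g x != x] = set0.
    by apply/setP => x; rewrite !inE (out_perm g1) ?inE ?eqxx.
  by move: sg; rewrite g0 cards0; lia.
have AE := cardsD1 a A; rewrite aA add1n in AE.
rewrite -sum1_card (partition_big (fun g : {perm T} => g a) (mem A)) /=; last first.
  by move=> g; rewrite inE => /and3P[gA _ _]; rewrite perm_closed.
rewrite (bigD1 a) //= AE /=.
have EF b : (\sum_(g in invol_on A j | g a == b) 1 = #|[set g in invol_on A j | g a == b]|)%N.
  by rewrite -sum1_card; apply: eq_bigl => g; rewrite !inE.
rewrite EF invol_on_fix // IH; last by lia.
congr (_ + _)%N; case: j EF => [|j] EF.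
  rewrite big1; first by case: #|_|.
  move=> b /andP[bA ba]; rewrite EF; apply/eqP; rewrite cards_eq0; apply/eqP/setP => g.
  rewrite !inE muln0 cards_eq0; apply/negP => /andP[/and3P[_ _ /eqP/setP/(_ a) H] /eqP ga].
  by move: H; rewrite !inE ga ba.
have EM b : b \in A -> b != a -> #|[set g in invol_on A j.+1 | g a == b]| = ninv #|A :\ a|.-1 j.
  move=> bA ba; rewrite invol_on_move // 1?eq_sym // card_imset; last exact: mulgI.
  have := cardsD1 b (A :\ a); rewrite !inE ba bA add1n /= => E.
  by rewrite IH ?E //; lia.
rewrite (eq_bigr (fun=> ninv #|A :\ a|.-1 j)) => [|b /andP[bA ba]]; last by rewrite EF EM.
rewrite sum_nat_const (_ : #|_| = #|A :\ a|); last by apply: eq_card => b; rewrite !inE unfold_in andbC.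
by case: #|A :\ a|.
Qed.
End Involutions.

(** * Cycle types of involutions, and power sums *)

Section CycleType.
Variable n : nat.
Implicit Type g : 'S_n.

Definition porbit_sizes g : seq nat := [seq #|X| | X : {set 'I_n} <- enum (porbits g)].

Lemma count1_porbit_sizes g : count_mem 1%N (porbit_sizes g) = #|[set x | g x == x]|.
Proof.
rewrite count_map -sum1_count big_enum_cond /= -(card_imset _ (@set1_inj _)) -sum1_card.
apply: eq_bigl => X; apply/andP/imsetP => [[/imsetP[x _ ->] /cards1P[y E]]|[x + ->]].
  have := porbit_id g x; have := mem_porbit g 1 x; rewrite expg1 E !inE => /eqP gx /eqP xy.
  by exists x; rewrite ?inE ?gx xy.
rewrite inE => /eqP gx; rewrite cards1; split=> //.
suff <- : porbit g x = [set x] by apply: imset_f.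
apply/setP => y; rewrite inE; apply/porbitP/eqP => [[i ->]|->]; last by exists 0%N; rewrite expg0 perm1.
by elim: i => [|i IH]; rewrite ?expg0 ?perm1 // expgSr permM IH gx.
Qed.

Lemma sumn_porbit_sizes g : sumn (porbit_sizes g) = n.
Proof.
rewrite sumnE big_map big_enum /= -[RHS]card_ord -sum1_card.
rewrite (partition_big (porbit g) (mem (porbits g))) /=; last by move=> x _; apply: imset_f.
apply: eq_bigr => X /imsetP[x _ ->]; rewrite -sum1_card; apply: eq_bigl => y.
by rewrite eq_porbit_mem.
Qed.

Lemma count12 (s : seq nat) : all (fun x => (x == 1) || (x == 2))%N s ->
  perm_eq s (nseq (count_mem 2 s) 2 ++ nseq (count_mem 1 s) 1)%N /\
  sumn s = (2 * count_mem 2 s + count_mem 1 s)%N.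
Proof.
move=> s12; split; last by elim: s s12 => //= x s IH /andP[/orP[] /eqP -> /IH] /= ->; lia.
apply/seq.permP => a; rewrite count_cat !count_nseq.
elim: s s12 => [|x s IH] /=; first by rewrite !muln0.
by case/andP => /orP[] /eqP -> /IH -> /=; lia.
Qed.

Lemma invol_porbit_sizes g : (g * g == 1)%g ->
  all (fun x => (x == 1) || (x == 2))%N (porbit_sizes g).
Proof.
move=> gg; apply/allP => _ /mapP[X + ->]; rewrite mem_enum => /imsetP[x _ ->].
have sub : porbit g x \subset [set x; g x].
  apply/subsetP => y /porbitP[i ->]; rewrite !inE.
  elim: i => [|i]; first by rewrite expg0 perm1 eqxx.
  rewrite expgSr permM => /orP[] /eqP ->; first by rewrite eqxx orbT.
  by rewrite involK ?eqxx.
have := subset_leq_card sub; rewrite cards2 => le.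
have gt0 : (0 < #|porbit g x|)%N by apply/card_gt0P; exists x; apply: porbit_id.
by move: le gt0; case: #|porbit g x| (x != g x) => [|[|[|k]]] [].
Qed.

Lemma sorted_nseq12 j k : sorted geq (nseq j 2 ++ nseq k 1)%N.
Proof.
case: j => [|j] /=.
  by case: k => //= k; elim: k => //= k ->.
elim: j => [|j IH] /=; last by rewrite IH.
by case: k => //= k; elim: k => //= k ->.
Qed.

(** Orbits of size 1 or 2 mean that [g * g] fixes every point. Conversely the orbit sizes of an
    involution are 1 or 2, so the number of fixed points determines their multiset, and sorting
    gives the sequence. *)
Lemma cycle_type12 g j : (2 * j <= n)%N ->
  (cycle_type g == nseq j 2 ++ nseq (n - 2 * j) 1)%N = (g \in invol_on [set: 'I_n] j).
Proof.
move=> jn; rewrite inE /cycle_type -/(porbit_sizes g).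
have fixE : (#|[set x | g x == x]| + #|[set x | g x != x]| = n)%N.
  rewrite -[RHS]card_ord -(cardsC [set x | g x == x]); congr addn.
  by apply: eq_card => x; rewrite !inE.
have -> : perm_on [set: 'I_n] g by apply/subsetP => x; rewrite inE.
rewrite /=; apply/eqP/andP => [E|[gg /eqP sg]].
  have pe : perm_eq (porbit_sizes g) (nseq j 2 ++ nseq (n - 2 * j) 1)%N.
    by rewrite -E perm_sym perm_sort.
  have fx : #|[set x | g x == x]| = (n - 2 * j)%N.
    rewrite -count1_porbit_sizes (seq.permP pe) count_cat !count_nseq /=; lia.
  split; last by rewrite -(eqn_add2l (n - 2 * j)) -[X in (X + _ == _)%N]fx fixE subnK.
  apply/eqP/permP => x; rewrite perm1 permM.
  have : #|porbit g x| \in porbit_sizes g.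
    by apply: map_f; rewrite mem_enum; apply: imset_f.
  rewrite (perm_mem pe) mem_cat !mem_nseq => /orP[] /andP[_ /eqP E'].
    by have := iter_porbit g x; rewrite E'.
  by have := iter_porbit g x; rewrite E' /= => gx; rewrite !gx.
have [pe sm] := count12 (invol_porbit_sizes gg).
rewrite sumn_porbit_sizes count1_porbit_sizes in sm pe.
have arith a b c : (n = 2 * a + b -> b + c = n -> c = 2 * j -> b = n - 2 * j /\ a = j)%N by lia.
have [c1 c2] := arith _ _ _ sm fixE sg.
rewrite c1 c2 in pe.
have geq_total : total geq by move=> a b /=; apply: leq_total.
have geq_trans : transitive geq by move=> a b c /= ba ac; apply: leq_trans ac ba.
have geq_anti : antisymmetric geq by move=> a b /= /andP[ba ab]; apply/anti_leq/andP.
have /(perm_sortP geq_total geq_trans geq_anti) -> := pe.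
by apply: sorted_sort => //; apply: sorted_nseq12.
Qed.

(** Used to see that the class is nonempty, so that the choice in [a_val] succeeds. *)
Lemma card_cycle_type12 j : (2 * j <= n)%N ->
  #|[set g : 'S_n | cycle_type g == nseq j 2 ++ nseq (n - 2 * j) 1]%N| = ninv n j.
Proof.
move=> jn; rewrite -[in RHS](card_ord n) -cardsT -card_invol_on.
by apply: eq_card => g; rewrite inE cycle_type12.
Qed.

(** A word fixed by [g] amounts to a free choice of one letter for each cycle. *)
Lemma wordsum_cycles (R : comNzRingType) L g :
  wordsum R L g = \prod_(X in porbits g) \sum_(i < L) 'X_i ^+ #|X|.
Proof.
rewrite big_enum_val bigA_distr_bigA /=.
have mem_rk x : porbit g x \in porbits g by apply: imset_f.
pose rk x : 'I_#|porbits g| := enum_rank_in (mem_rk x) (porbit g x).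
have rkK x : enum_val (rk x) = porbit g x by rewrite enum_rankK_in // imset_f.
have ex_rep (k : 'I_#|porbits g|) : exists x, porbit g x == enum_val k.
  by have /imsetP[x _ ->] := enum_valP k; exists x.
pose rep k := xchoose (ex_rep k).
have repK k : porbit g (rep k) = enum_val k by apply/eqP/(xchooseP (ex_rep k)).
have rk_rep k : rk (rep k) = k by apply: enum_val_inj; rewrite rkK repK.
have rk_g x : rk (g x) = rk x.
  apply: enum_val_inj; rewrite !rkK; apply/eqP; rewrite eq_porbit_mem.
  by rewrite -[g]expg1 mem_porbit.
rewrite /wordsum (reindex_onto (fun F : {ffun 'I_#|porbits g| -> 'I_L} => [ffun x => F (rk x)])
   (fun f : {ffun 'I_n -> 'I_L} => [ffun k => f (rep k)])) /=; last first.
  move=> f /forallP fg; apply/ffunP => x; rewrite !ffunE.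
  have : rep (rk x) \in porbit g x by rewrite -eq_porbit_mem repK rkK.
  case/porbitP => i ->; elim: i => [|i IH]; first by rewrite expg0 perm1.
  by rewrite expgSr permM (eqP (fg _)).
rewrite (eq_bigl predT) => [|F]; last first.
  apply/andP; split; first by apply/forallP => x; rewrite !ffunE rk_g.
  by apply/eqP/ffunP => k; rewrite !ffunE rk_rep.
apply: eq_bigr => F _; rewrite (partition_big rk predT) //=; apply: eq_bigr => k _.
rewrite -prodr_const; apply: eq_big => [x|x /eqP <-]; last by rewrite ffunE.
apply/eqP/idP => [<-|xk]; first by rewrite rkK porbit_id.
apply: enum_val_inj; rewrite rkK -repK; apply/eqP; rewrite eq_porbit_mem repK //.
Qed.

Lemma wordsum_cycle_type12 (R : comNzRingType) L g j :
  cycle_type g = (nseq j 2 ++ nseq (n - 2 * j) 1)%N ->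
  wordsum R L g = (\sum_(i < L) 'X_i) ^+ (n - 2 * j) * (\sum_(i < L) 'X_i ^+ 2) ^+ j.
Proof.
move=> E; rewrite wordsum_cycles.
rewrite -big_enum /=.
rewrite -(big_map (fun X : {set 'I_n} => #|X|) xpredT (fun k => \sum_(i < L) 'X_i ^+ k)).
have pe : perm_eq (porbit_sizes g) (nseq j 2 ++ nseq (n - 2 * j) 1)%N.
  by rewrite -E perm_sym perm_sort.
rewrite (perm_big _ pe) big_cat /= !big_nseq mulrC !iter_mulr_1.
by congr (_ ^+ _ * _); apply: eq_bigr => i _; rewrite expr1.
Qed.
End CycleType.

Arguments ninv : simpl never.

(** * Hermite polynomials *)

Section ExpLike.
Variable A : comNzRingType.
Implicit Types (a b : A) (P Q : {poly A}).

(* [P] agrees up to degree [N] with the power series [exp (a t - b t^2 / 2)]. *)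
Definition explike N a b P : Prop :=
  P`_0 = 1 /\ forall k, (k < N)%N -> (P^`())`_k = ((a%:P - b *: 'X) * P)`_k.

Lemma coef_mul_eq N P Q S : (forall k, (k < N)%N -> P`_k = Q`_k) ->
  forall k, (k < N)%N -> (P * S)`_k = (Q * S)`_k.
Proof.
move=> PQ k kN; rewrite !coefM; apply: eq_bigr => i _; rewrite PQ //.
by have := ltn_ord i; lia.
Qed.

Lemma explike_mul N a b P a' b' Q :
  explike N a b P -> explike N a' b' Q -> explike N (a + a') (b + b') (P * Q).
Proof.
move=> [P0 HP] [Q0 HQ]; split=> [|k kN]; first by rewrite coef0M P0 Q0 mulr1.
rewrite derivM coefD [P * Q^`()]mulrC (coef_mul_eq _ HP) // (coef_mul_eq _ HQ) // -coefD.
apply: (congr1 (fun p : {poly A} => p`_k)); rewrite polyCD scalerDl; ring.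
Qed.

Lemma explike1 N : explike N 0 0 1.
Proof.
split=> [|k _]; first by rewrite coef1.
by rewrite -polyC1 derivC polyC0 scale0r subrr mul0r.
Qed.

Lemma explike_prod N (I : finType) (a b : I -> A) (P : I -> {poly A}) :
  (forall i, explike N (a i) (b i) (P i)) ->
  explike N (\sum_i a i) (\sum_i b i) (\prod_i P i).
Proof.
move=> HP; elim/big_rec3: _ => [|i p y x _ IH]; first exact: explike1.
exact: explike_mul.
Qed.

Lemma coef_explike_rhs a b P k :
  ((a%:P - b *: 'X) * P)`_k = a * P`_k - b * (if k is k'.+1 then P`_k' else 0).
Proof.
rewrite mulrBl coefB coefCM -scalerAl coefZ coefXM.
by case: k.
Qed.

(** The differential equation [P' = (a - b t) P] determines the coefficients successively, once
    positive integers can be cancelled; [reg] provides this in a ring without division. *)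
Lemma explike_uniq N a b P Q :
  (forall k (x y : A), k.+1%:R * x = k.+1%:R * y -> x = y) ->
  explike N a b P -> explike N a b Q -> forall k, (k <= N)%N -> P`_k = Q`_k.
Proof.
move=> reg [P0 HP] [Q0 HQ]; elim/ltn_ind => -[|k] IH kN; first by rewrite P0.
apply: (reg k); rewrite !mulr_natl -!coef_deriv HP // HQ // !coef_explike_rhs IH //; last exact: ltnW.
by case: k IH kN => // k IH kN; rewrite IH //; lia.
Qed.

(** Here [c k] plays the role of [1 / k!]. Read coefficientwise, the differential equation is the
    three-term recurrence of Hermite type satisfied by [e]. *)
Lemma explike_seq N a b (c e : nat -> A) :
  c 0 = 1 -> (forall n, c n.+1 * n.+1%:R = c n) ->
  e 0 = 1 -> e 1 = a -> (forall n, e n.+2 = a * e n.+1 - n.+1%:R * b * e n) ->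
  explike N a b (\poly_(k < N.+1) (c k * e k)).
Proof.
move=> c0 cS e0 e1 eS; split=> [|k kN]; first by rewrite coef_poly /= c0 e0 mulr1.
rewrite coef_deriv coef_explike_rhs !coef_poly ltnS kN ltnS (ltnW kN) -mulr_natr.
case: k kN => [|k] kN; first by rewrite e1 -(cS 0) e0; ring.
rewrite coef_poly ltnS (ltnW (ltnW kN)) eS -(cS k.+1) -(cS k) -(cS k.+1); ring.
Qed.

(** Involutions weighted by [a] for each fixed point and [- b] for each two-cycle. Terms with
    [2 * j] above [n] vanish with [ninv]. *)
Definition invol_poly a b n : A :=
  \sum_(j < n.+1) (ninv n j)%:R * (-1) ^+ j * a ^+ (n - 2 * j) * b ^+ j.

Lemma invol_poly0 a b : invol_poly a b 0 = 1.
Proof. by rewrite /invol_poly big_ord1 ninv0 !expr0 !mulr1. Qed.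

Lemma invol_poly1 a b : invol_poly a b 1 = a.
Proof.
rewrite /invol_poly big_ord_recr big_ord1 /= ninv0 (@ninv_gt 1 1) // !expr0 !mulr1 expr1.
by rewrite mul1r !mul0r addr0.
Qed.

Lemma invol_polySS a b n :
  invol_poly a b n.+2 = a * invol_poly a b n.+1 - n.+1%:R * b * invol_poly a b n.
Proof.
pose f m j : A := (ninv m j)%:R * (-1) ^+ j * a ^+ (m - 2 * j) * b ^+ j.
have f0 m j : (m < 2 * j)%N -> f m j = 0.
  by move=> mj; rewrite /f ninv_gt // !mul0r.
(* Both sums are lengthened by a vanishing term, so that after splitting off [j = 0] the recurrence
   of [ninv] applies termwise. *)
have E : \sum_(j < n.+3) a * f n.+1 j = a * invol_poly a b n.+1.
  rewrite -mulr_sumr big_ord_recr /= (f0 _ n.+2) ?addr0 //; lia.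
have E' : \sum_(j < n.+2) n.+1%:R * b * f n j = n.+1%:R * b * invol_poly a b n.
  rewrite -mulr_sumr big_ord_recr /= (f0 _ n.+1) ?addr0 //; lia.
rewrite -E -E' [X in _ = X - _]big_ord_recl [LHS]big_ord_recl -addrA -sumrB.
congr (_ + _); first by rewrite /f !ninv0 !muln0 !subn0 !expr0 !mulr1 !mul1r -exprS.
apply: eq_bigr => j _; rewrite /f !lift0 ninvSS.
rewrite (_ : n.+2 - 2 * j.+1 = n - 2 * j)%N; last by lia.
rewrite natrD natrM !exprS.
have [nj|nj] := ltnP n.+1 (2 * j.+1); first by rewrite (ninv_gt nj); ring.
by rewrite (_ : n - 2 * j = (n.+1 - 2 * j.+1).+1)%N ?exprS; [ring|lia].
Qed.
End ExpLike.

Section HermiteSeq.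
Variable R : comNzRingType.

Lemma He0 : He R 0 = 1. Proof. by []. Qed.
Lemma He1 : He R 1 = 'X. Proof. by []. Qed.

Lemma HeSS n : He R n.+2 = 'X * He R n.+1 - n.+1%:R *: He R n.
Proof. by rewrite /He /=; case: (He_pair R n). Qed.

Lemma deriv_He n : (He R n.+1)^`() = n.+1%:R *: He R n.
Proof.
elim/ltn_ind: n => -[|[|n]] IH; first by rewrite He1 He0 derivX scale1r.
  rewrite HeSS He1 He0 scale1r derivB derivM derivX mul1r mulr1 -polyC1 derivC subr0.
  by rewrite scaler_nat mulr2n.
rewrite HeSS derivB derivM derivX mul1r derivZ !IH // -scalerAr -addrA -scalerBr -HeSS.
by rewrite -[n.+3%:R]nat1r scalerDl scale1r.
Qed.

Lemma derivn_He n i : (He R n)^`(i) = (n ^_ i)%:R *: He R (n - i).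
Proof.
elim: i n => [|i IH] n; first by rewrite derivn0 ffactn0 subn0 scale1r.
rewrite derivSn; case: n => [|n]; first by rewrite He0 derivC -[0 in LHS]polyC0 derivnC if_same scale0r.
by rewrite deriv_He linearZ /= IH ffactSS subSS scalerA natrM.
Qed.
End HermiteSeq.

Section HermiteWords.
Variable L : nat.
Notation P := {poly algC}.
Notation A := {mpoly P[L]}.

Definition hermite_h (k : nat) : P := (k`!%:R^-1)%:P * He algC k.

Lemma natr_mpoly_reg k (x y : A) : k.+1%:R * x = k.+1%:R * y -> x = y.
Proof.
move=> E; have : ((k.+1%:R^-1)%:P)%:MP * (k.+1%:R * x) = ((k.+1%:R^-1)%:P)%:MP * (k.+1%:R * y) :> A.
  by rewrite E.
have <- : (k.+1%:R%:P)%:MP_[L] = k.+1%:R :> A by rewrite !rmorph_nat.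
by rewrite !mulrA -rmorphM -polyCM mulVf ?pnatr_eq0 // !mul1r.
Qed.

Lemma coef_prod_mpoly (h : nat -> P) n (nu : 'X_{1..L}) : mdeg nu = n ->
  ((\prod_(i < L) \poly_(k < n.+1) ((h k)%:MP * 'X_i ^+ k : A))`_n)@_nu = \prod_i h (nu i).
Proof.
move=> nun.
have -> : \prod_(i < L) \poly_(k < n.+1) ((h k)%:MP * 'X_i ^+ k : A) =
  \prod_(i < L) \sum_(k < n.+1) ((h k)%:MP * 'X_i ^+ k) *: 'X^k.
  by apply: eq_bigr => i _; rewrite poly_def.
rewrite bigA_distr_bigA coef_sum raddf_sum /=.
have E (m : {ffun 'I_L -> 'I_n.+1}) :
   ((\prod_(i < L) (((h (m i))%:MP * 'X_i ^+ m i) *: 'X^(m i)))`_n)@_nu =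
   (\prod_i h (m i)) * ([multinom (m i : nat) | i < L] == nu)%:R.
  rewrite scaler_prod prodrXr coefZ coefXn big_split /=.
  have <- : (\prod_(i < L) h (m i))%:MP_[L] = \prod_(i < L) (h (m i))%:MP_[L].
    by rewrite rmorph_prod.
  rewrite -mulrA mcoeffCM; congr (_ * _).
  have -> : \prod_(i < L) 'X_i ^+ m i = 'X_[P, [multinom (m i : nat) | i < L]].
    by rewrite mpolyXE_id; apply: eq_bigr => j _; rewrite mnmE.
  case: eqP => [_|/eqP ne]; first by rewrite mulr1 mcoeffX.
  rewrite mulr0 mcoeff0; case: eqP => // mnu; case/eqP: ne.
  by rewrite -[LHS]nun -mnu mdegE; apply: eq_bigr => j _; rewrite mnmE.
under eq_bigr do rewrite E.
have nuN j : (nu j < n.+1)%N by rewrite ltnS -nun mdegE (bigD1 j) //= leq_addr.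
rewrite (bigD1 [ffun j => Ordinal (nuN j)]) //= [X in _ + X]big1 ?addr0 => [|m mn].
  rewrite (_ : _ == nu) ?mulr1; last by apply/eqP/mnmP => i; rewrite mnmE ffunE.
  by apply: eq_bigr => i _; rewrite ffunE.
case: eqP => [mnu|_]; last by rewrite mulr0.
case/eqP: mn; apply/ffunP => j; apply: val_inj.
by rewrite ffunE /= -mnu mnmE.
Qed.

(** Both sides are [n!] times the coefficient of [t^n y^nu] in [exp (x p_1 t - p_2 t^2 / 2)],
    computed from the recurrence of [invol_poly] and from the product over the variables. *)
Lemma hermite_invol_poly n (nu : 'X_{1..L}) : mdeg nu = n ->
  (invol_poly (\sum_(i < L) ('X : P)%:MP * 'X_i) (\sum_(i < L) 'X_i ^+ 2 : A) n)@_nu =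
  n`!%:R * \prod_i hermite_h (nu i).
Proof.
move=> nun; pose c k : A := ((k`!%:R^-1)%:P)%:MP.
have c0 : c 0%N = 1 by rewrite /c fact0 invr1.
have cS k : c k.+1 * k.+1%:R = c k.
  have <- : (k.+1%:R%:P)%:MP_[L] = k.+1%:R :> A by rewrite !rmorph_nat.
  rewrite /c -rmorphM -polyCM factS natrM invfM mulrAC mulVf ?mul1r //.
  by rewrite pnatr_eq0.
have HE := @explike_seq A n _ _ c _ c0 cS (invol_poly0 _ _) (invol_poly1 _ _)
  (invol_polySS (\sum_(i < L) ('X : P)%:MP * 'X_i) (\sum_(i < L) 'X_i ^+ 2)).
have HH (i : 'I_L) : explike n (('X : P)%:MP * 'X_i : A) ('X_i ^+ 2)
    (\poly_(k < n.+1) ((hermite_h k)%:MP * 'X_i ^+ k)).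
  have -> : \poly_(k < n.+1) ((hermite_h k)%:MP * 'X_i ^+ k) =
            \poly_(k < n.+1) (c k * ((He algC k)%:MP * 'X_i ^+ k)) :> {poly A}.
    by apply/polyP => k; rewrite !coef_poly; case: ifP => // _; rewrite rmorphM mulrA.
  apply: explike_seq => // [|k]; first by rewrite mulr1.
  rewrite HeSS -mul_polyC rmorphB !rmorphM /=.
  have -> : (k.+1%:R%:P)%:MP_[L] = k.+1%:R :> A by rewrite !rmorph_nat.
  by rewrite !exprS; ring.
have := explike_uniq natr_mpoly_reg HE (explike_prod HH) (leqnn n).
rewrite coef_poly ltnSn => /(congr1 (mcoeff nu)).
rewrite coef_prod_mpoly // mcoeffCM => <-.
by rewrite mulrA -polyC_natr -polyCM divff ?mul1r // pnatr_eq0 -lt0n fact_gt0.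
Qed.

(** [gsel] picks a representative of each class. Its word sum is [p_1 ^+ (n - 2 * j) * p_2 ^+ j], so
    the left side is the coefficient at [nu] of an [invol_poly]. *)
Theorem sum_invol_fixc n (nu : 'X_{1..L}) (gsel : nat -> 'S_n) : mdeg nu = n ->
  (forall j, (2 * j <= n)%N -> cycle_type (gsel j) = nseq j 2 ++ nseq (n - 2 * j) 1)%N ->
  \sum_(j < n./2.+1) (ninv n j)%:R * (-1) ^+ j * 'X^(n - 2 * j) * (fixc nu (gsel j))%:R =
  n`!%:R * \prod_i hermite_h (nu i).
Proof.
move=> nun Hg; rewrite -(hermite_invol_poly nun) /invol_poly raddf_sum /=.
pose f j : P := (ninv n j)%:R * (-1) ^+ j * 'X^(n - 2 * j) * (fixc nu (gsel j))%:R.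
have le : (n./2.+1 <= n.+1)%N by lia.
rewrite (big_ord_widen _ f le) big_mkcond; apply: eq_bigr => j _.
case: ltnP => [jn|nj]; last first.
  by rewrite ninv_gt ?mul0r ?mcoeff0 //; lia.
have jn' : (2 * j <= n)%N by lia.
rewrite /f -mcoeff_wordsum (wordsum_cycle_type12 _ _ (Hg j jn')) -mulr_sumr exprMn.
rewrite -!mcoeffCM !rmorphM !rmorphXn rmorphN1 rmorph_nat /=.
by congr (_@__); ring.
Qed.
End HermiteWords.

(** * Standard Young tableaux *)

Section Tableaux.
Variable N : nat.
Implicit Types (f : nat -> nat) (T : {ffun 'I_N * 'I_N -> 'I_N}) (c d : 'I_N * 'I_N).

Definition cell f c : bool := (c.2 < f c.1)%N.

(* Tableaux of shape [f] with entries below [m], inside a fixed square grid so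
   that erasing the largest entry does not change the type. *)
Definition tableau f m T : bool :=
  [&& [forall c, cell f c ==> (T c < m)%N],
      [forall c, ~~ cell f c ==> (T c == 0%N :> nat)],
      [forall c, forall d, (cell f c && cell f d && (T c == T d)) ==> (c == d)],
      [forall c, forall d, [&& cell f c, cell f d, c.1 == d.1 & (c.2 < d.2)%N] ==> (T c < T d)%N] &
      [forall c, forall d, [&& cell f c, cell f d, c.2 == d.2 & (c.1 < d.1)%N] ==> (T c < T d)%N]].

Definition tableau_spec f m T : Prop :=
  [/\ forall c, cell f c -> (T c < m)%N,
      forall c, ~~ cell f c -> T c = 0%N :> nat,
      forall c d, cell f c -> cell f d -> T c = T d -> c = d,
      forall c d, cell f c -> cell f d -> c.1 = d.1 -> (c.2 < d.2)%N -> (T c < T d)%N &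
      forall c d, cell f c -> cell f d -> c.2 = d.2 -> (c.1 < d.1)%N -> (T c < T d)%N].

Lemma tableauP f m T : reflect (tableau_spec f m T) (tableau f m T).
Proof.
apply: (iffP and5P) => -[H1 H2 H3 H4 H5]; split.
- by move=> c; apply/implyP/(forallP H1).
- by move=> c fc; apply/eqP; apply: implyP (forallP H2 c) fc.
- move=> c d fc fd E; apply/eqP.
  by apply: (implyP (forallP (forallP H3 c) d)); rewrite fc fd E eqxx.
- move=> c d fc fd E lt; apply: (implyP (forallP (forallP H4 c) d)).
  by rewrite fc fd E eqxx.
- move=> c d fc fd E lt; apply: (implyP (forallP (forallP H5 c) d)).
  by rewrite fc fd E eqxx.
- by apply/forallP => c; apply/implyP/H1.
- by apply/forallP => c; apply/implyP => fc; apply/eqP/H2.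
- apply/forallP => c; apply/forallP => d; apply/implyP => /andP[/andP[fc fd] /eqP E].
  by apply/eqP/H3.
- apply/forallP => c; apply/forallP => d; apply/implyP => /and4P[fc fd /eqP E lt].
  exact: H4.
- apply/forallP => c; apply/forallP => d; apply/implyP => /and4P[fc fd /eqP E lt].
  exact: H5.
Qed.

Definition upd T c (v : 'I_N) : {ffun 'I_N * 'I_N -> 'I_N} :=
  [ffun d => if d == c then v else T d].

Definition dec f i : nat -> nat := fun k => (f k - (k == i))%N.

Definition corner f i : bool := (f i.+1 < f i)%N.

(** A shape with at most [N] cells lies inside the [N] by [N] grid, so no cell is lost there. *)
Lemma card_cells f m L : (forall i j, (i <= j)%N -> (f j <= f i)%N) ->
  (forall i, (L <= i)%N -> f i = 0%N) -> (\sum_(i < L) f i = m)%N -> (m <= N)%N ->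
  [/\ forall i, (f i <= N)%N, forall i, (N <= i)%N -> f i = 0%N &
      #|[set c | cell f c]| = m].
Proof.
move=> f_noninc f0 sum_f mN.
have fm i : (f i <= m)%N.
  have [iL|/f0 -> //] := ltnP i L.
  by rewrite -sum_f (bigD1 (Ordinal iL)) //= leq_addr.
have fN i : (N <= i)%N -> f i = 0%N.
  move=> Ni; apply/eqP; rewrite -leqn0 leqNgt; apply/negP => fi.
  have iL : (i < L)%N by rewrite ltnNge; apply/negP => /f0 E; rewrite E in fi.
  suff : (i.+1 <= m)%N by lia.
  rewrite -sum_f -[X in (X <= _)%N]muln1 -[X in (X * _)%N]card_ord -sum_nat_const.
  rewrite (big_ord_widen L (fun=> 1%N)) // big_mkcond; apply: leq_sum => k _.
  by case: ifP => // ki; apply: leq_trans fi _; apply: f_noninc.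
split=> // [i|]; first exact: leq_trans (fm i) mN.
rewrite -sum1_card (eq_bigl (fun c => predT c.1 && (c.2 < f c.1)%N)); last first.
  by move=> c; rewrite inE.
rewrite -(pair_big_dep predT (fun i j : 'I_N => (j < f i)%N) (fun _ _ => 1%N)) /=.
transitivity (\sum_(i < N) f i)%N.
  apply: eq_bigr => i _; rewrite -(big_ord_widen N (fun=> 1%N)) ?sum1_card ?card_ord //.
  exact: leq_trans (fm i) mN.
rewrite -sum_f; have [NL|LN] := leqP N L.
  rewrite (big_ord_widen L f NL) big_mkcond; apply: eq_bigr => i _.
  by case: ltnP => // /fN.
rewrite (big_ord_widen N f (ltnW LN)) [RHS]big_mkcond; apply: eq_bigr => i _.
by case: ltnP => // /f0.
Qed.

(** A cell to the right of the largest entry, or below it, would need a larger entry. *)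
Lemma tableau_corner f m T c : (forall i, f i <= N)%N -> (forall i, (N <= i)%N -> f i = 0%N) ->
  tableau_spec f m.+1 T -> cell f c -> T c = m :> nat ->
  corner f c.1 /\ c.2 = (f c.1).-1 :> nat.
Proof.
move=> fN f0 [Tm _ _ Trow Tcol] fc Tc.
have E2 : c.2 = (f c.1).-1 :> nat.
  move: (fc); rewrite /cell leq_eqVlt => /orP[/eqP <- //|lt].
  have ltN := leq_trans lt (fN c.1).
  have fd : cell f (c.1, Ordinal ltN) by [].
  by have := Trow c _ fc fd erefl (ltnSn _); have := Tm _ fd; rewrite Tc; lia.
split=> //; rewrite /corner ltnNge; apply/negP => le.
have ltN : (c.1.+1 < N)%N.
  by rewrite ltnNge; apply/negP => /f0 E; move: (fc) le; rewrite /cell E; lia.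
have fd : cell f (Ordinal ltN, c.2) by rewrite /cell /=; apply: leq_trans fc le.
by have := Tcol c _ fc fd erefl (ltnSn _); have := Tm _ fd; rewrite Tc; lia.
Qed.

(** Here [T] is the tableau after erasure: at [c] it has the default value 0 required off the shape,
    and writing [v] there restores the largest entry. *)
Lemma tableau_upd f m T c (z v : 'I_N) : corner f c.1 -> c.2 = (f c.1).-1 :> nat ->
  (forall i j, (i <= j)%N -> (f j <= f i)%N) ->
  z = 0%N :> nat -> v = m :> nat ->
  tableau f m.+1 (upd T c v) && (T c == z) = tableau (dec f c.1) m T.
Proof.
move=> fc c2 f_noninc z0 vm; rewrite /corner in fc.
have cc : cell f c by rewrite /cell c2; lia.
have cE d : cell (dec f c.1) d = cell f d && (d != c).
  rewrite /cell /dec -pair_eqE /pair_eq /= -!val_eqE /=.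
  by case: eqP => [->|] /=; rewrite ?subn0 ?andbT // c2; lia.
apply/andP/tableauP => [[/tableauP[Tm T0 Ti Tr Tc] /eqP Tcz]|[Tm T0 Ti Tr Tc]].
  have U d : d != c -> upd T c v d = T d by rewrite ffunE => /negPf ->.
  have Uc : upd T c v c = v by rewrite ffunE eqxx.
  split.
  - move=> d; rewrite cE => /andP[fd dc]; have := Tm d fd; rewrite U // ltnS leq_eqVlt.
    case/orP => [/eqP E|//]; case/negP: (dc); apply/eqP/Ti => //.
    by rewrite (U d dc) Uc; apply: val_inj; rewrite /= E vm.
  - move=> d; rewrite cE negb_and negbK; have [-> _|dc] := eqVneq d c; first by rewrite Tcz.
    by rewrite orbF => /T0; rewrite U.
  - move=> d e; rewrite !cE => /andP[fd dc] /andP[fe ec] E; apply: Ti => //.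
    by rewrite !U.
  - move=> d e; rewrite !cE => /andP[fd dc] /andP[fe ec] E lt.
    by rewrite -(U d) // -(U e) //; apply: Tr.
  - move=> d e; rewrite !cE => /andP[fd dc] /andP[fe ec] E lt.
    by rewrite -(U d) // -(U e) //; apply: Tc.
have ncc : ~~ cell (dec f c.1) c by rewrite cE eqxx andbF.
split; last by apply/eqP/val_inj; rewrite /= z0 T0.
apply/tableauP; split.
- move=> d fd; rewrite ffunE; case: eqP => [_|/eqP dc]; first by rewrite vm.
  by apply: ltnW; apply: Tm; rewrite cE fd.
- move=> d fd; rewrite ffunE; case: eqP => [E|/eqP dc]; first by rewrite E cc in fd.
  by apply: T0; rewrite cE negb_and fd.
- move=> d e fd fe; rewrite !ffunE; case: eqP => [->|/eqP dc]; case: eqP => [->|/eqP ec] //.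
  + by move=> /(congr1 val)/=; have := Tm e; rewrite cE fe ec vm => /(_ isT); lia.
  + by move=> /(congr1 val)/=; have := Tm d; rewrite cE fd dc vm => /(_ isT); lia.
  + by move=> E; apply: Ti => //; rewrite cE ?fd ?fe.
- move=> d e fd fe E lt; rewrite !ffunE.
  case: eqP => [Ed|/eqP dc].
    move: fe lt; rewrite /cell -E Ed c2; lia.
  have fd' : cell (dec f c.1) d by rewrite cE fd.
  case: eqP => [_|/eqP ec]; first by rewrite vm Tm.
  by apply: Tr => //; rewrite cE fe.
move=> d e fd fe E lt; rewrite !ffunE.
case: eqP => [Ed|/eqP dc].
  move: fe lt; rewrite /cell -E Ed c2 => H lt.
  by have := f_noninc _ _ lt; lia.
have fd' : cell (dec f c.1) d by rewrite cE fd.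
case: eqP => [_|/eqP ec]; first by rewrite vm Tm.
by apply: Tc => //; rewrite cE fe.
Qed.

(** Branching rule: the largest entry sits in a unique row, which is a corner, and erasing it is a
    bijection onto the tableaux of the smaller shape. *)
Lemma card_tableau_rec f m L : (forall i j, (i <= j)%N -> (f j <= f i)%N) ->
  (forall i, (L <= i)%N -> f i = 0%N) -> (\sum_(i < L) f i = m.+1)%N -> (m < N)%N ->
  #|[set T | tableau f m.+1 T]| =
    (\sum_(i < L | corner f i) #|[set T | tableau (dec f i) m T]|)%N.
Proof.
move=> f_noninc f0 sum_f mN; have [fN f0N cells] := card_cells f_noninc f0 sum_f mN.
pose A T (i : 'I_L) := [exists c, [&& cell f c, T c == m :> nat & c.1 == i :> nat]].
have A1 T : tableau f m.+1 T -> (\sum_i A T i = 1)%N.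
  move/tableauP => [Tm T0 Ti Tr Tc].
  (* There are [m.+1] cells and [m.+1] allowed values, so injectivity forces the value [m] to
     occur. *)
  have [c fc Ec] : exists2 c, cell f c & T c = m :> nat.
    have inj : {in [set c | cell f c] &, injective T}.
      by move=> c d; rewrite !inE; apply: Ti.
    have := card_in_imset inj; rewrite cells => cT.
    have sub : T @: [set c | cell f c] \subset [set v : 'I_N | (v < m.+1)%N].
      by apply/subsetP => _ /imsetP[c + ->]; rewrite !inE; apply: Tm.
    have cv : #|[set v : 'I_N | (v < m.+1)%N]| = m.+1.
      by rewrite cardsE -sum1_card -(big_ord_widen N (fun=> 1%N)) // sum1_card card_ord.
    have /eqP E : T @: [set c | cell f c] == [set v : 'I_N | (v < m.+1)%N].
      by rewrite eqEcard sub cT cv leqnn.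
    have : Ordinal mN \in [set v : 'I_N | (v < m.+1)%N] by rewrite inE /=.
    rewrite -E => /imsetP[c]; rewrite inE => fc Ec.
    by exists c => //; rewrite -Ec.
  have c1L : (c.1 < L)%N by rewrite ltnNge; apply/negP => /f0 E; move: fc; rewrite /cell E.
  rewrite (bigD1 (Ordinal c1L)) //= big1 => [|i ic].
    rewrite (_ : A T _ = true) //; apply/existsP; exists c.
    by rewrite fc Ec !eqxx.
  apply/eqP; rewrite eqb0; apply: contra ic => /existsP[d /and3P[fd /eqP Ed /eqP di]].
  have dc : d = c by apply: Ti => //; apply: val_inj; rewrite /= Ed Ec.
  by rewrite -val_eqE /= -di dc.
rewrite -sum1_card (eq_bigl (tableau f m.+1)); last by move=> T; rewrite inE.
rewrite (eq_bigr (fun T => \sum_i A T i)%N) => [|T /A1 ->//].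
rewrite exchange_big [RHS]big_mkcond /=; apply: eq_bigr => i _.
have ATP T : tableau f m.+1 T -> A T i -> corner f i.
  move=> /tableauP HT /existsP[c /and3P[fc /eqP Ec /eqP ci]].
  by rewrite -ci; case: (tableau_corner fN f0N HT fc Ec).
case: ifP => [fi|nfi]; last first.
  by apply: big1 => T HT; apply/eqP; rewrite eqb0; apply/negP => /(ATP T HT); rewrite nfi.
have fi0 : (0 < f i)%N by move: fi; rewrite /corner; lia.
have iN : (i < N)%N by rewrite ltnNge; apply/negP => /f0N E; rewrite E in fi0.
have jN : ((f i).-1 < N)%N by have := fN i; lia.
pose c := (Ordinal iN, Ordinal jN); pose v := Ordinal mN.
have z_lt : (0 < N)%N by lia.
pose z := Ordinal z_lt.
have cf : cell f c by rewrite /cell /=; lia.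
have AE T : tableau f m.+1 T && A T i = tableau f m.+1 T && (T c == v).
  case: (boolP (tableau _ _ _)) => //= HT; have /tableauP HT' := HT.
  apply/existsP/eqP => [[d /and3P[fd /eqP Ed /eqP di]]|Tc].
    have [_ d2] := tableau_corner fN f0N HT' fd Ed.
    have -> : c = d by apply/eqP; rewrite -pair_eqE /pair_eq /= -!val_eqE /= di d2 di !eqxx.
    exact: val_inj.
  by exists c; rewrite cf Tc /= !eqxx.
rewrite (eq_bigr (fun T => if A T i then 1 else 0)%N); last by move=> T _; case: (A T i).
rewrite -big_mkcondr (eq_bigl _ _ AE) (reindex_onto (fun T => upd T c v) (fun T => upd T c z)) /=.
  rewrite sum1_card; apply: eq_card => T; rewrite [RHS]inE [LHS]unfold_in.
  rewrite -(tableau_upd T (c := c) (z := z) (v := v)) //=.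
  rewrite [upd T c v c]ffunE (eqxx c) /= eqxx andbT; congr (_ && _).
  apply/eqP/eqP => [/ffunP/(_ c)|Tc]; first by rewrite !ffunE eqxx.
  by apply/ffunP => d; rewrite !ffunE; case: eqP => // ->.
move=> T /andP[_ /eqP Tc]; apply/ffunP => d; rewrite !ffunE.
by case: eqP => // ->.
Qed.

Lemma card_tableau0 f : (0 < N)%N -> (forall i, f i = 0%N) ->
  #|[set T | tableau f 0 T]| = 1%N.
Proof.
move=> N0 f0; pose z := Ordinal N0.
have cF c : cell f c = false by rewrite /cell f0.
apply/eqP/cards1P; exists [ffun=> z]; apply/setP => T; rewrite !inE.
apply/tableauP/eqP => [[_ T0 _ _ _]|->].
  by apply/ffunP => c; apply: val_inj; rewrite ffunE /= T0 ?cF.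
by split=> [c|c|c d|c d|c d]; rewrite ?ffunE ?cF.
Qed.

End Tableaux.

Lemma nSYT_tableau l :
  nSYT l = #|[set T | @tableau (psize l) (nth 0%N l) (psize l) T]|.
Proof.
apply: eq_card => T; rewrite !inE.
rewrite /is_SYT /tableau; apply/idP/idP.
  case/andP => /andP[H1 H2] H3; apply/and5P; split=> //.
  - by apply/forallP => c; apply/implyP => _; apply: ltn_ord.
  - apply/forallP => c; apply/forallP => d; apply/implyP => /and4P[fc fd E lt].
    have := forallP (forallP H3 c) d; rewrite [in_shape _ _]fc [in_shape _ _]fd => /andP[+ _].
    by rewrite val_eqE E lt.
  apply/forallP => c; apply/forallP => d; apply/implyP => /and4P[fc fd E lt].
  have := forallP (forallP H3 c) d; rewrite [in_shape _ _]fc [in_shape _ _]fd => /andP[_ +].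
  by rewrite val_eqE E lt.
case/and5P => _ H1 H2 H3 H4; rewrite H1 H2 /=.
apply/forallP => c; apply/forallP => d; apply/implyP => /andP[fc fd].
apply/andP; split; apply/implyP; rewrite val_eqE => /andP[E lt].
  by apply: (implyP (forallP (forallP H3 c) d)); rewrite [cell _ _]fc [cell _ _]fd E.
by apply: (implyP (forallP (forallP H4 c) d)); rewrite [cell _ _]fc [cell _ _]fd E.
Qed.

(** * The determinant of inverse factorials and the number of tableaux *)

Definition invfact (a b : nat) : algC := if (b <= a)%N then ((a - b)`!)%:R^-1 else 0.

Definition invfact_det L (f : nat -> nat) : algC :=
  \det (\matrix_(i < L, j < L) invfact (f i + stair i) (stair j)).

Lemma invfactS a b : invfact a b.+1 = (a%:R - b%:R) * invfact a b.
Proof.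
rewrite /invfact; case: (ltngtP b a) => [ba|ab|->]; last 2 first.
- by rewrite ?mulr0.
- by rewrite subrr mul0r.
rewrite -natrB ?(ltnW ba) // subnS; have : (0 < a - b)%N by rewrite subn_gt0.
case: (a - b)%N => // k _; rewrite factS natrM invfM mulrA divff ?mul1r //.
by rewrite pnatr_eq0.
Qed.

Lemma invfact_pred a b : (0 < a)%N -> invfact a b.+1 = invfact a.-1 b.
Proof. by case: a => // a _; rewrite /invfact ltnS subSS. Qed.

(** Lowering the factorials in row [i] by one removes a box from that row and multiplies the entries
    by [a - b]. In each Leibniz term these factors, summed over the rows, add up to [m]. *)
Lemma invfact_det_rec L f m : (forall i j, (i <= j)%N -> (f j <= f i)%N) ->
  (forall i, (L <= i)%N -> f i = 0%N) -> (\sum_(i < L) f i = m)%N ->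
  m%:R * invfact_det L f = \sum_(i < L | corner f i) invfact_det L (dec f i).
Proof.
move=> f_noninc f0 sum_f.
pose A (i : 'I_L) := \matrix_(k < L, j < L)
  (if k == i then invfact (f k + stair k) (stair j).+1 else invfact (f k + stair k) (stair j)).
transitivity (\sum_(i < L) \det (A i)).
  rewrite /invfact_det /determinant mulr_sumr exchange_big /=; apply: eq_bigr => s _.
  rewrite -mulr_sumr mulrCA; congr (_ * _).
  have -> : m%:R = \sum_(i < L) ((f i + stair i)%:R - (stair (s i))%:R) :> algC.
    have E : (\sum_(i < L) stair (s i) = \sum_(i < L) stair i)%N.
      by rewrite [RHS](reindex_inj (@perm_inj _ s)).
    by rewrite sumrB -!natr_sum big_split /= E sum_f natrD addrK.
  rewrite mulr_suml; apply: eq_bigr => i _.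
  rewrite (bigD1 i) //= [in RHS](bigD1 i) //= !mxE eqxx invfactS mulrA; congr (_ * _).
  by apply: eq_bigr => k /negPf ki; rewrite !mxE ki.
rewrite [RHS]big_mkcond; apply: eq_bigr => i _; case: ifP => [ci|/negbT ci].
  congr (\det _); apply/matrixP => k j; rewrite !mxE /dec.
  case: eqP => [->|/eqP/negPf ki]; last by rewrite val_eqE ki subn0.
  rewrite eqxx invfact_pred; last by move: ci; rewrite /corner; lia.
  by congr invfact; move: ci; rewrite /corner; lia.
(* Without a corner in row [i], rows [i] and [i.+1] of [A i] coincide, or row [i] is the last one
   and is zero. *)
have ci' : f i = f i.+1.
  by apply/eqP; rewrite eqn_leq [X in _ && X]f_noninc // andbT leqNgt.
have [iL|iL] := ltnP i.+1 L.
  pose i' := Ordinal iL.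
  have ii' : i != i' by rewrite -val_eqE /=; lia.
  apply: (determinant_alternate ii') => j; rewrite !mxE eqxx eq_sym (negPf ii').
  rewrite invfact_pred; last by rewrite /stair; lia.
  have H a b : (b.+1 < L)%N -> (a + (L - 1 - b)).-1 = (a + (L - 1 - b.+1))%N by lia.
  by congr invfact; rewrite ci'; apply: (H (f i.+1) i iL).
have fi0 : f i = 0%N by rewrite ci' f0.
rewrite (expand_det_row _ i) big1 // => j _; rewrite !mxE eqxx fi0 /invfact.
by rewrite ifF ?mul0r // /stair; have := ltn_ord i; move: iL; lia.
Qed.

(** Induction on [m] with the grid fixed: after division by [m!], both sides obey the same
    recurrence over corners. *)
Theorem card_tableau N L f m : (forall i j, (i <= j)%N -> (f j <= f i)%N) ->
  (forall i, (L <= i)%N -> f i = 0%N) -> (\sum_(i < L) f i = m)%N ->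
  (m <= N)%N -> (0 < N)%N ->
  (#|[set T | @tableau N f m T]|)%:R = (m`!)%:R * invfact_det L f.
Proof.
elim: m f => [|m IHm] f f_noninc f0 sum_f mN N0.
  have fz i : f i = 0%N.
    have [iL|/f0 //] := ltnP i L; apply/eqP; rewrite -leqn0 -sum_f.
    by rewrite (bigD1 (Ordinal iL)) //= leq_addr.
  rewrite card_tableau0 // fact0 mul1r /invfact_det -det_tr det_trig; last first.
    apply/is_trig_mxP => i j ij; rewrite !mxE fz /invfact ifF //.
    by rewrite /stair; move: (ltn_ord j) ij => /=; lia.
  rewrite big1 // => i _; rewrite !mxE fz /invfact leqnn subnn fact0 invr1 //.
rewrite (card_tableau_rec f_noninc f0 sum_f mN) natr_sum factS natrM -mulrA mulrCA.
rewrite (invfact_det_rec f_noninc f0 sum_f) mulr_sumr; apply: eq_bigr => i ci.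
have di k : dec f i k = (f k - (k == i))%N by [].
apply: IHm => // [a b ab|a La||]; last by exact: ltnW.
- rewrite !di; have := f_noninc _ _ ab; case: (eqVneq a i) => [Ea|]; last by lia.
  have [->|nb] := eqVneq b i; first by rewrite Ea.
  move=> _; have : (f b <= f i.+1)%N.
    by apply: f_noninc; rewrite ltn_neqAle -Ea eq_sym ab andbT Ea.
  by move: ci; rewrite /corner Ea; lia.
- by rewrite di f0.
have E1 : (\sum_(k < L) (k == i) = 1)%N.
  by rewrite (bigD1 i) //= eqxx big1 // => k /negPf ki; rewrite ki.
apply: (@addIn 1%N); rewrite [RHS]addn1 -sum_f -[in LHS]E1 -big_split.
apply: eq_bigr => k _ /=; rewrite di val_eqE subnK //.
by case: eqP => // ->; move: ci; rewrite /corner; lia.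
Qed.

Lemma nSYTE l : is_partition l ->
  (nSYT l)%:R = ((psize l)`!)%:R * invfact_det (size l) (nth 0%N l).
Proof.
move=> lP; rewrite nSYT_tableau.
have [n0|n0] := posnP (psize l); last first.
  apply: card_tableau => //; first by move=> i j; apply: nth_partition.
    by move=> i; apply: nth_default.
  by rewrite psizeE.
(* The grid is empty here, outside the scope of [card_tableau]; exactly one function is defined on
   it. *)
have l0 : l = [::].
  case/andP: lP => _; case: l n0 => //= a l; rewrite /psize /=; lia.
rewrite {}l0 /invfact_det det_mx00 mulr1 /psize /= fact0; congr _%:R.
apply/eqP/cards1P; exists [ffun c => c.1]; apply/setP => T; rewrite !inE.
apply/tableauP/eqP => [_|_]; first by apply/ffunP => -[[]].
by split=> -[[]].
Qed.

(** * Determinants and the main theorem *)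

Lemma det_rows_scale (R : comNzRingType) L (c : 'I_L -> R) (M : 'I_L -> 'I_L -> R) :
  \det (\matrix_(i, j) (c i * M i j)) = (\prod_i c i) * \det (\matrix_(i, j) M i j).
Proof.
rewrite /determinant mulr_sumr; apply: eq_bigr => s _.
rewrite mulrCA -big_split; congr (_ * _).
by apply: eq_bigr => i _; rewrite !mxE.
Qed.

(** The sign of reversing the columns, from derivative order to staircase order; it occurs in both
    the Wronskian and [Delta_deg] and cancels. *)
Definition rev_sign (R : comNzRingType) L : R := (-1) ^+ perm (@rev_ord_inj L).

Lemma det_stair (R : comNzRingType) L (F : 'I_L -> nat -> R) :
  \det (\matrix_(i < L, j < L) F i j) =
  rev_sign R L * \det (\matrix_(i < L, j < L) F i (stair j)).
Proof.
have -> : \matrix_(i < L, j < L) F i j =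
   col_perm (perm (@rev_ord_inj L)) (\matrix_(i < L, j < L) F i (stair j)).
  apply/matrixP => i j; rewrite !mxE permE; congr F.
  by rewrite /stair /=; have := ltn_ord j; lia.
by rewrite col_permE det_mulmx det_perm odd_permV mulrC.
Qed.

Lemma size_ffact_poly i : size (\prod_(t < i) ('X - (t%:R)%:P) : {poly algC}) = i.+1.
Proof. by rewrite -(big_mkord xpredT (fun t => 'X - (t%:R)%:P)) size_prod_XsubC size_iota subn0. Qed.

Lemma horner_ffact_poly n i :
  (\prod_(t < i) ('X - (t%:R)%:P) : {poly algC}).[n%:R] = (n ^_ i)%:R.
Proof.
elim: i => [|i IH]; first by rewrite big_ord0 hornerC.
rewrite big_ord_recr hornerM IH hornerXsubC ffactnSr natrM /=.
have [ni|ni] := leqP i n; first by rewrite natrB.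
by rewrite ffact_small // !mul0r.
Qed.

(** Falling factorials are monic of degree [j], so a unitriangular change of basis reduces the
    determinant to Vandermonde's. *)
Lemma det_ffact L (a : 'I_L -> nat) :
  \det (\matrix_(i < L, j < L) (a i ^_ j)%:R) =
  \prod_(i < L) \prod_(j < L | (i < j)%N) ((a j)%:R - (a i)%:R) :> algC.
Proof.
pose p j : {poly algC} := \prod_(t < j) ('X - (t%:R)%:P).
pose r : 'rV[algC]_L := \row_i (a i)%:R.
have -> : \matrix_(i < L, j < L) (a i ^_ j)%:R =
    (Vandermonde L r)^T *m \matrix_(k < L, j < L) (p j)`_k.
  apply/matrixP => i j; rewrite !mxE -horner_ffact_poly (@horner_coef_wide _ L); last first.
    by rewrite size_ffact_poly.
  by apply: eq_bigr => k _; rewrite !mxE mulrC.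
rewrite det_mulmx det_tr det_Vandermonde -[RHS]mulr1; congr (_ * _).
  by apply: eq_bigr => i _; apply: eq_bigr => j _; rewrite !mxE.
rewrite -det_tr det_trig; last first.
  apply/is_trig_mxP => i j ij; rewrite !mxE nth_default // size_ffact_poly //.
apply: big1 => i _; rewrite !mxE.
have := monic_prod_XsubC (index_enum 'I_i) predT (fun t : 'I_i => (t%:R : algC)).
by rewrite monicE lead_coefE size_ffact_poly /= => /eqP.
Qed.

Lemma ffact_invfact n i : (n ^_ i)%:R = (n`!)%:R * invfact n i.
Proof.
rewrite /invfact; case: leqP => [le|lt]; last by rewrite ffact_small // mulr0.
by rewrite -(ffact_fact le) natrM mulfK // pnatr_eq0 -lt0n fact_gt0.
Qed.

Lemma Delta_degE l :
  (Delta_deg l)%:~R = \prod_(i < size l) (degvec l i)`!%:R *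
    (rev_sign algC (size l) * invfact_det (size l) (nth 0%N l)) :> algC.
Proof.
transitivity (\det (\matrix_(i < size l, j < size l) (degvec l i ^_ j)%:R) : algC).
  rewrite det_ffact /Delta_deg rmorph_prod; apply: eq_bigr => i _.
  by rewrite rmorph_prod; apply: eq_bigr => j _; rewrite rmorphB.
have -> : \matrix_(i < size l, j < size l) (degvec l i ^_ j)%:R =
  \matrix_(i < size l, j < size l) ((degvec l i)`!%:R * invfact (degvec l i) j).
  by apply/matrixP => i j; rewrite !mxE ffact_invfact.
rewrite det_rows_scale; congr (_ * _).
rewrite (det_stair (fun i : 'I_(size l) => invfact (degvec l i))); congr (_ * \det _).
by apply/matrixP => i j; rewrite !mxE degvecE.
Qed.

Lemma Delta_deg_neq0 l : is_partition l -> (Delta_deg l)%:~R != 0 :> algC.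
Proof.
move=> lP; rewrite intr_eq0 /Delta_deg; apply/prodf_neq0 => i _; apply/prodf_neq0 => j ij.
rewrite subr_eq0 eqz_nat; apply/eqP => E.
by have := degvec_inj lP E => ji; rewrite ji ltnn in ij.
Qed.

Definition hermite_shift a b : {poly algC} :=
  if (b <= a)%N then hermite_h (a - b) else 0.

Lemma derivn_He_shift n i :
  (He algC n)^`(i) = (n`!%:R)%:P * hermite_shift n i.
Proof.
rewrite derivn_He /hermite_shift; case: leqP => [le|lt]; last first.
  by rewrite ffact_small // scale0r mulr0.
rewrite /hermite_h mulrA -polyCM mul_polyC ffact_invfact /invfact le.
by congr (_ *: _).
Qed.

(** The row factors [n_i!] and the sign are those of [Delta_degE], so the quotient defining [HeW] is
    a ratio of two determinants. *)
Lemma Wronskian_He l :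
  Wronskian (fun i : 'I_(size l) => He algC (degvec l i)) =
  (\prod_(i < size l) (degvec l i)`!%:R * rev_sign algC (size l))%:P *
  \det (\matrix_(i < size l, j < size l) hermite_shift (degvec l i) (stair j)).
Proof.
rewrite /Wronskian -det_tr.
have -> : (\matrix_(i < size l, j < size l) (He algC (degvec l j))^`(i))^T =
  \matrix_(i < size l, j < size l) (((degvec l i)`!%:R)%:P * hermite_shift (degvec l i) j).
  by apply/matrixP => i j; rewrite !mxE derivn_He_shift.
rewrite det_rows_scale (det_stair (fun i : 'I_(size l) => hermite_shift (degvec l i))).
by rewrite mulrA polyCM rmorph_prod /rev_sign rmorphXn rmorphN1.
Qed.

Lemma nSYT_HeW l : is_partition l ->
  (nSYT l)%:R *: HeW l = (psize l)`!%:R *: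
  \det (\matrix_(i < size l, j < size l) hermite_shift (degvec l i) (stair j)).
Proof.
move=> lP; rewrite /HeW Wronskian_He nSYTE // mul_polyC !scalerA; congr (_ *: _).
(* Since [Delta_deg] is nonzero, so is each of its three factors, in particular [invfact_det], which
   then cancels against the one in [nSYTE]. *)
have := Delta_deg_neq0 lP; rewrite Delta_degE; set a := \prod_(i < _) _; set e := rev_sign _ _.
set d := invfact_det _ _; rewrite !mulf_eq0 !negb_or => /and3P[a0 e0 d0].
by field; rewrite a0 e0 d0.
Qed.

Theorem theorem4p2 (l : seq nat) (hl : is_partition l) :
  (nSYT l)%:R *: HeW l =
  \sum_(j < (psize l)./2.+1)
    (((-1) ^+ j * ((psize l)`!)%:R /
       ((j`!)%:R * ((psize l - 2 * j)`!)%:R * 2 ^+ j) * a_val l j) *: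
     'X^(psize l - 2 * j)) :> {poly algC}.
Proof.
set n := psize l.
(* The same choice as in [a_val]; for [2 * j <= n] the default is never reached, since the class has
   [ninv n j] elements and [ninv_fact] makes that number nonzero. *)
pose gsel j : 'S_n :=
  odflt 1%g [pick g | cycle_type g == nseq j 2%N ++ nseq (n - 2 * j) 1%N].
have gselP j : (2 * j <= n)%N ->
    cycle_type (gsel j) = (nseq j 2 ++ nseq (n - 2 * j) 1)%N /\
    a_val l j = spechtchar l (gsel j).
  move=> jn; rewrite /gsel /a_val; case: pickP => [g /eqP gj|none] /=.
    by rewrite chi_partE.
  have := card_cycle_type12 jn; rewrite (_ : [set g | _] = set0); last first.
    by apply/setP => g; rewrite !inE none.
  have := ninv_fact jn; rewrite cards0 => + E; rewrite -E mul0n => /esym/eqP.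
  by rewrite -leqn0 leqNgt fact_gt0.
rewrite nSYT_HeW //.
rewrite -(@sum_det_shift _ l hermite_h (fun nu => \prod_i hermite_h (nu i))) //.
transitivity (\sum_(j < n./2.+1) (ninv n j)%:R * (-1) ^+ j * 'X^(n - 2 * j) *
   (spechtchar l (gsel j))%:P); last first.
  apply: eq_bigr => j _; have jn : (2 * j <= n)%N by have := ltn_ord j; lia.
  have [_ ->] := gselP j jn; rewrite -/n.
  have E : n`!%:R / (j`!%:R * (n - 2 * j)`!%:R * 2 ^+ j) = (ninv n j)%:R :> algC.
    rewrite -(ninv_fact jn) !natrM natrX mulfK //.
    by rewrite !mulf_eq0 expf_eq0 !pnatr_eq0 !gtn_eqF ?fact_gt0 ?andbF.
  rewrite -[_ * n`!%:R / _]mulrA E -mul_polyC !polyCM polyC_exp polyCN polyC_natr; ring.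
rewrite /spechtchar.
under [RHS]eq_bigr do rewrite rmorph_sum mulr_sumr.
(* With the sum over [w] outermost, each content [lambda + delta - w(delta)] is handled separately
   by [sum_invol_fixc]. *)
rewrite exchange_big scaler_sumr; apply: eq_bigr => w /forallP wl.
pose nu : 'X_{1..size l} := [multinom (degvec l i - stair (w i))%N | i < size l].
have nun : mdeg nu = n.
  by rewrite mdegE /n -(sum_shift wl); apply: eq_bigr => i _; rewrite mnmE.
have H := sum_invol_fixc nun (fun j jn => (gselP j jn).1).
have -> : \prod_(i < size l) hermite_h (degvec l i - stair (w i))%N =
          \prod_(i < size l) hermite_h (nu i).
  by apply: eq_bigr => i _; rewrite mnmE.
rewrite scalerAr scaler_nat -mulr_natl -H mulr_sumr; apply: eq_bigr => j _.
rewrite /= polyCM polyC_exp polyCN polyC_natr.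
have -> : fixc nu (gsel j) = fixc (fun i : 'I_(size l) => degvec l i - stair (w i))%N (gsel j).
  apply: eq_card => f; rewrite !inE; congr (_ && _).
  by apply: eq_forallb => i; rewrite mnmE.
by rewrite polyC1 [RHS]mulrCA.
Qed.
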